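(* Let $a\ge 1$, $a\ge b\ge 0$ be integers, $n=a+b$, $\pi\in\mathfrak S_n$, let $\Gamma=\Gamma_\pi$ be the consistent dimer model associated to $\Delta(a,b)$, $Q$ its dual quiver, $\omega\in\mathfrak S_n$, and let $C_\omega\subset\Theta(Q)_{\mathbb R}$ be the chamber corresponding to the sequence $\mathcal Z_\omega=(u_{\omega(1)},\dots,u_{\omega(n)})$ of zigzag paths. For $k\in\{1,\dots,n-1\}$, let $\ell_k$ be the exceptional curve in $\mathcal M_{C_\omega}$ which is the torus orbit $\mathcal O_\tau$ for the two-dimensional cone $\tau=\tau_{\omega,k}$ of the fan $\Sigma_\omega$. Consider the chamber $C_{\omega s_k}$, separated from $C_\omega$ by the wall $W_k=\{\sum_{v\in\mathcal R_k}\theta_v=0\}$, $\mathcal R_k=\mathcal R(u_{\omega(k)},u_{\omega(k+1)})$, where $s_k$ is the adjacent transposition swapping $k$ and $k+1$. Then, for the cone $\tau':=\tau_{\omega s_k,k}$ of the fan $\Sigma_{\omega s_k}$, we have $$\operatorname{Supp}M_{\tau'}=\mathbb S_{u_{\omega(k+1)}}\mathbb S_{u_{\omega(k)}}(\operatorname{Supp}M_\tau).$$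
   Context: **Dimer models, quivers, stability.** A dimer model $\Gamma$ is a finite bipartite graph (nodes coloured black or white) on $\mathbb T=\mathbb R^2/\mathbb Z^2$ inducing a polygonal cell decomposition. A zigzag path is a closed path making a maximal turn to the right at each black node and a maximal turn to the left at each white node; its edges traversed from white to black are its zigs, the others its zags ($\mathrm{Zig}(z)$, $\mathrm{Zag}(z)$); its slope $[z]\in H_1(\mathbb T)\cong\mathbb Z^2$ is its homology class. The quiver $Q$ dual to $\Gamma$ has the faces as vertices and the edges as arrows, an arrow crossing its edge with the white node on the right. Relations: for every arrow $a$, $\gamma_a^+=\gamma_a^-$, where $\gamma_a^+$ (resp. $\gamma_a^-$) is the path from the head of $a$ to the tail of $a$ going around the white (resp. black) node of the edge dual to $a$. Representations are representations of $Q$ over $\mathbb C$ satisfying these relations, of dimension vector $(1,\dots,1)$; the support $\operatorname{Supp}M$ is the set of arrows acting by a nonzero map. Put $\Theta(Q)_{\mathbb R}=\{\theta\in\mathbb R^{Q_0}\mid\sum_v\theta_v=0\}$ and $\theta(N)=\sum_v\theta_v\dim N_v$. A representation $M$ is $\theta$-semistable (resp. $\theta$-stable) if $\theta(N)\ge0$ for all subrepresentations $N$ (resp. $\theta(N)>0$ for all nonzero proper $N$); $\theta$ is generic if every $\theta$-semistable representation is $\theta$-stable. For generic $\theta$, $\mathcal M_\theta$ is the fine moduli space of $\theta$-stable representations, a projective crepant resolution of $\operatorname{Spec}\mathbb C[x,y,z,w]/(xy-z^aw^b)$. Two generic parameters are equivalent if they have the same stable representations; equivalence classes are open cones called chambers,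 and walls are codimension one faces of closures of chambers. $\mathcal M_C=\mathcal M_\theta$ for $\theta\in C$. **The dimer model $\Gamma_\pi$.** $\Delta(a,b)$ is the polygon with vertices $(0,0),(a,0),(b,1),(0,1)$. Put $i_k=-1$ for $k\le a$, $i_k=+1$ for $a<k\le n$; arguments of $\pi$ are read modulo $n$ in $\{1,\dots,n\}$. Let $S$ be a vertical infinite chain of rhombi of side $1$ with horizontal diagonal $1$ and vertical diagonal $\sqrt3$, consecutive ones sharing a vertex; let $H$ be a vertical infinite chain of regular hexagons of side $1$, consecutive ones sharing a horizontal edge. Tile the plane by strips indexed by $k\in\mathbb Z$ from left to right, consecutive strips glued along their zigzag boundary lines, strip $k$ being a copy of $S$ if $i_{\pi(k)}\ne i_{\pi(k+1)}$ and of $H$ otherwise; label every polygon of strip $k$ by $k$ mod $n$. Colour the vertices bipartitely and divide by the lattice generated by the upward translation by one polygon (second basis vector of $H_1(\mathbb T)$) and a translation carrying strip $0$ to strip $n$ (first basis vector). The colouring and the second translation are chosen so that the zigzag polygon of the resulting dimer model is $\Delta(a,b)$ (up to translation), i.e. the slopes of its zigzag paths with multiplicity are $(0,-1)$ ($a$ times), $(0,1)$ ($b$ times), $(1,a-b)$, $(-1,0)$. The result is $\Gamma_\pi$; its faces (vertices of $Q$) are labelled $0,\dots,n-1$. **Zigzag paths $u_k$.** For $k=1,\dots,n$, $u_k$ is the zigzag path formed by the boundary line between strips $k-1$ and $k$ (edges shared by the faces $k-1$ and $k$ mod $n$). Let $z_1,\dots,z_a$ (resp. $w_1,\dots,w_b$)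 be those of slope $(0,-1)$ (resp. $(0,1)$). Each $\mathrm{Zig}(u_k)$ and $\mathrm{Zag}(u_k)$ is a single edge; $\mathsf{zig}(u_k)$, $\mathsf{zag}(u_k)$ denote the dual arrows. For $i\ne j$, $\mathcal R(u_i,u_j)=\{\min(i,j),\dots,\max(i,j)-1\}\subset Q_0$, the vertices dual to faces in the part of $\mathbb T$ cut out by $u_i,u_j$ not containing face $0$. **Fan and perfect matchings.** For generic $\theta$, $\mathcal M_\theta$ is a smooth toric variety whose fan in $\mathbb R^3$ consists of the cones over the cells, at height one, of a triangulation of $\Delta(a,b)$ into elementary triangles (denoted $\Delta_C$ for $\theta$ in a chamber $C$). A perfect matching is a set of edges such that every node lies on exactly one of them. For a lattice point $q\in\Delta(a,b)$ and a point of the 2-dimensional torus orbit of the ray through $(q,1)$, the set of edges dual to arrows acting by zero is a perfect matching $P^\theta_q$ depending only on $q$ and the chamber of $\theta$. The identification of lattices is normalized so that $P^\theta_{(0,0)}\supset\bigcup\mathrm{Zig}(z_k)$, $P^\theta_{(a,0)}\supset\bigcup\mathrm{Zag}(z_k)$, $P^\theta_{(0,1)}\supset\bigcup\mathrm{Zag}(w_k)$, $P^\theta_{(b,1)}\supset\bigcup\mathrm{Zig}(w_k)$. **Correspondence between chambers and sequences.** For $\theta\in C$ there are unique orderings $(z_{k_1},\dots,z_{k_a})$, $(w_{k'_1},\dots,w_{k'_b})$ such that $P^\theta_{(i,0)}$ contains the zags of $z_{k_1},\dots,z_{k_i}$ and the zigs of $z_{k_{i+1}},\dots,z_{k_a}$,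 and $P^\theta_{(j,1)}$ contains the zigs of $w_{k'_1},\dots,w_{k'_j}$ and the zags of $w_{k'_{j+1}},\dots,w_{k'_b}$. Number the triangles $\Delta_{C,1},\dots,\Delta_{C,n}$ of $\Delta_C$ in the order in which the segment from $(0,\frac12)$ to $(a,\frac12)$ crosses them; $\operatorname{sgn}(\Delta_{C,k})=+1$ (resp. $-1$) if $\Delta_{C,k}$ shares a side with the upper (resp. lower) base; $\operatorname{sgn}(w_k)=+1$, $\operatorname{sgn}(z_k)=-1$. $C$ corresponds to the unique $\mathcal Z_\omega$ with $\operatorname{sgn}(u_{\omega(k)})=\operatorname{sgn}(\Delta_{C,k})$ for all $k$ whose subsequence of paths of sign $-1$ is $(z_{k_1},\dots,z_{k_a})$ and of sign $+1$ is $(w_{k'_1},\dots,w_{k'_b})$. This is a bijection between chambers and $\{\mathcal Z_\omega\mid\omega\in\mathfrak S_n\}$; $C_\omega$ is the chamber of $\mathcal Z_\omega$, $\Sigma_\omega$ the fan of $\mathcal M_{C_\omega}$, $\Delta_{\omega,k}=\Delta_{C_\omega,k}$, and $\tau_{\omega,k}\in\Sigma_\omega$ the two-dimensional cone over $\Delta_{\omega,k}\cap\Delta_{\omega,k+1}$. For a two-dimensional cone $\tau\in\Sigma_\omega$, $M_\tau$ is any $\theta$-stable representation ($\theta\in C_\omega$) corresponding to a point of the 1-dimensional torus orbit $\mathcal O_\tau\subset\mathcal M_{C_\omega}$; $\operatorname{Supp}M_\tau$ depends only on $\tau$, and for every $i$ it contains either $\mathsf{zig}(u_i)$ or $\mathsf{zag}(u_i)$.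 **The operation $\mathbb S$.** For a set $V\subset Q_1$ containing either $\mathsf{zig}(u_i)$ or $\mathsf{zag}(u_i)$ for every $i$, $\mathbb S_{u_i}(V)=(V\setminus\{\mathsf{zig}(u_i)\})\cup\{\mathsf{zag}(u_i)\}$ if $\mathsf{zig}(u_i)\in V$, and $\mathbb S_{u_i}(V)=(V\setminus\{\mathsf{zag}(u_i)\})\cup\{\mathsf{zig}(u_i)\}$ if $\mathsf{zag}(u_i)\in V$. *)

(* Defs.v *)
From HB Require Import structures.
From mathcomp Require Import all_boot all_order all_algebra all_fingroup.
From mathcomp Require Import boolp classical_sets reals.
From mathcomp Require Import complex.

Set Implicit Arguments.
Unset Strict Implicit.
Unset Printing Implicit Defensive.

Import Order.TTheory GRing.Theory Num.Theory.
Local Open Scope ring_scope.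

(** * The dimer model [Gamma_pi] and its dual quiver

    Indexing, with [n = a + b]: the ordinal [j : 'I_n] used for a zigzag path,
    for a position in a sequence of zigzag paths, or for a value of [pi] or
    [omega], stands for [j + 1] in {1, .., n}.  The ordinal [f : 'I_n] used for
    a face (a vertex of the quiver, a strip of the tiling) stands for [f]
    itself.  Hence [u_(j+1)], the line between strips [j] and [j + 1], is
    called [j] here; it lies between the faces [j] (on its left) and [ordS j]
    (on its right), and the strip [f] lies between the lines [ord_pred f] and
    [f]. *)

Section Dimer.
Variables (a b : nat) (pi : {perm 'I_(a + b)}).
Local Notation n := (a + b)%N.

(* [i_(pi(j + 1))]; it is also the sign of the zigzag path [j], +1 for slope
   (0, 1) and -1 for slope (0, -1).  If [a = b] the opposite colouring has the
   same zigzag polygon; it is the present one for another permutation [pi]. *)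
Definition sgn (j : 'I_n) : int := if (pi j < a)%N then -1 else 1.

(* The strip [f] consists of hexagons (otherwise of rhombi). *)
Definition hexagonal (f : 'I_n) : bool := sgn (ord_pred f) == sgn f.

(* Modulo the vertical translation by one polygon, each line carries one node
   [L] on its left corner and one node [R] on its right corner, and two edges
   joining them: the edge of direction "\" (encoded by [true]) and the edge of
   direction "/" (encoded by [false]).  Each hexagonal strip carries one more
   edge, the horizontal one. *)
Definition edge : finType :=
  (('I_n * bool) + {f : 'I_n | hexagonal f})%type.

(* A line is coloured so that it is a zigzag path when directed upwards if its
   sign is +1 (then [L] is black and [R] is white) and downwards if its sign is
   -1 (then [L] is white and [R] is black).  In both cases the edge "\" is
   traversed from white to black: see [zigzag_zig] and [zigzag_zag]. *)
Definition zig (j : 'I_n) : edge := inl (j, true).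
Definition zag (j : 'I_n) : edge := inl (j, false).

(* The edges at the [R]-node of the line on the left of the strip [f], and at
   the [L]-node of the line on its right, in counterclockwise order.  These two
   nodes are joined by the horizontal edge if the strip consists of hexagons,
   and coincide if it consists of rhombi. *)
Definition star_rhombus (f : 'I_n) : seq edge :=
  [:: zig f; zag f; zig (ord_pred f); zag (ord_pred f)].

Definition star_R (f : 'I_n) : seq edge :=
  if insub f is Some h then [:: zig (ord_pred f); zag (ord_pred f); inr h]
  else star_rhombus f.

Definition star_L (f : 'I_n) : seq edge :=
  if insub f is Some h then [:: zig f; zag f; inr h] else star_rhombus f.

(* The strip containing the edge, or lying just on the left, resp. right, of
   the line containing it; and a line adjacent to the edge. *)
Definition strip_left (e : edge) : 'I_n :=
  match e with inl (j, _) => j | inr h => val h end.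
Definition strip_right (e : edge) : 'I_n :=
  match e with inl (j, _) => ordS j | inr h => val h end.
Definition line (e : edge) : 'I_n :=
  match e with inl (j, _) => j | inr h => val h end.

Definition white_star (e : edge) : seq edge :=
  if sgn (line e) == 1 then star_R (strip_right e) else star_L (strip_left e).
Definition black_star (e : edge) : seq edge :=
  if sgn (line e) == 1 then star_L (strip_left e) else star_R (strip_right e).

(* The vertices of the quiver are the faces ['I_n]; its arrows are the edges,
   an arrow crossing its edge with the white node on the right. *)
Definition left_to_right (j : 'I_n) (z : bool) : bool := z == (sgn j == 1).
Definition tail (e : edge) : 'I_n :=
  match e with
  | inl (j, z) => if left_to_right j z then j else ordS j
  | inr h => val h
  end.
Definition head (e : edge) : 'I_n :=
  match e with
  | inl (j, z) => if left_to_right j z then ordS j else j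
  | inr h => val h
  end.

(* The paths from [head e] to [tail e] around the white and the black node
   of [e]; arrows turn clockwise around white nodes and counterclockwise around
   black ones. *)
Definition rest_of_cycle (e : edge) (c : seq edge) : seq edge :=
  behead (rot (index e c) c).
Definition gamma_plus (e : edge) : seq edge :=
  rest_of_cycle e (rev (white_star e)).
Definition gamma_minus (e : edge) : seq edge :=
  rest_of_cycle e (black_star e).

(* Arriving at a black node, the maximal turn to the right is the next edge in
   counterclockwise order; arriving at a white node, the maximal turn to the
   left is the previous one. *)
Lemma zigzag_zig (j : 'I_n) : next (black_star (zig j)) (zig j) = zag j.
Proof.
have neq i : (zig j == zag i) = false by rewrite eqE /= xpair_eqE andbF.
rewrite /black_star /star_L /star_R /star_rhombus /=.
case: ifP => _; case: insub => [h|]; rewrite ?ordSK /= ?neq ?eqxx //=.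
by case: eqP => [[<-]|].
Qed.

Lemma zigzag_zag (j : 'I_n) : prev (white_star (zag j)) (zag j) = zig j.
Proof.
have neq i : (zag j == zig i) = false by rewrite eqE /= xpair_eqE andbF.
rewrite /white_star /star_L /star_R /star_rhombus /=.
case: ifP => _; case: insub => [h|]; rewrite ?ordSK /= ?neq ?eqxx //=.
by case: eqP => [[<-]|].
Qed.

End Dimer.

(** * Representations of dimension vector (1, .., 1) and stability *)

Section Representations.
Variables (R : realType) (a b : nat) (pi : {perm 'I_(a + b)}).
Local Notation n := (a + b)%N.
Local Notation edge := (edge pi).

Definition rep := {ffun edge -> R[i]}.

Definition relations (M : rep) : Prop :=
  forall e, \prod_(x <- gamma_plus e) M x = \prod_(x <- gamma_minus e) M x.

Definition Supp (M : rep) : {set edge} := [set e | M e != 0].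

(* A subrepresentation is given by a subspace of the line at each vertex, that
   is, by the set [N] of the vertices where this subspace is not 0. *)
Definition subrep (M : rep) (N : {set 'I_n}) : Prop :=
  forall e, M e != 0 -> tail e \in N -> head e \in N.

Definition param := {ffun 'I_n -> R}.

Definition Theta (theta : param) : Prop := \sum_v theta v = 0.

Definition weight (theta : param) (N : {set 'I_n}) : R := \sum_(v in N) theta v.

Definition semistable (theta : param) (M : rep) : Prop :=
  relations M /\ forall N, subrep M N -> 0 <= weight theta N.

Definition stable (theta : param) (M : rep) : Prop :=
  relations M /\ forall N, subrep M N -> N != finset.set0 -> N != [set: 'I_n]%SET ->
    0 < weight theta N.

Definition generic (theta : param) : Prop :=
  forall M, semistable theta M -> stable theta M.

Definition chamber (C : set param) : Prop :=
  exists theta0 : param, [/\ Theta theta0, generic theta0 &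
    forall theta, C theta <->
      [/\ Theta theta, generic theta &
        forall M, stable theta M <-> stable theta0 M]].

(** * The moduli space as a toric variety

    The points of [M_theta] are the isomorphism classes of stable
    representations.  The torus is the group of the representations all of
    whose arrows act by nonzero scalars, up to isomorphism; it acts by
    multiplication of the scalars. *)

Definition iso (M M' : edge -> R[i]) : Prop :=
  exists g : 'I_n -> R[i], (forall v, g v != 0) /\
    forall e, M' e = g (head e) * M e / g (tail e).

Definition same_orbit (M M' : rep) : Prop :=
  exists t : rep, [/\ relations t, forall e, t e != 0 &
    iso (fun e => t e * M e) M'].

(* Cocharacters of the torus of representations with nonzero scalars; those of
   the torus of [M_theta] are obtained by dividing by the [potential]s. *)
Definition cochar (d : {ffun edge -> int}) : Prop :=
  forall e, \sum_(x <- gamma_plus e) d x = \sum_(x <- gamma_minus e) d x.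

Definition potential (d : {ffun edge -> int}) : Prop :=
  exists eta : 'I_n -> int, forall e, d e = eta (head e) - eta (tail e).

(* The limit at [t = 0] of the one-parameter subgroup [t |-> t ^ d] is the
   class of [M], for [M] stable: [M_theta] is a fine moduli space, and line
   bundles on the affine line are trivial, so a morphism from the affine line
   to [M_theta] is a family [F] of representations. *)
Definition one_param_limit (d : {ffun edge -> int}) (M : rep) : Prop :=
  exists F : edge -> {poly R[i]},
    (forall t : R[i], t != 0 -> iso (fun e => t ^ d e) (fun e => (F e).[t])) /\
    iso (fun e => (F e).[0]) M.

(* The lattice points of [Delta(a, b)]: [inl i] is (i, 0), [inr j] is (j, 1). *)
Definition lpoint : finType := ('I_a.+1 + 'I_b.+1)%type.
Definition xc (q : lpoint) : nat :=
  match q with inl i => i | inr j => j end.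
Definition yc (q : lpoint) : nat :=
  match q with inl _ => 0%N | inr _ => 1%N end.

Definition lift1 (q : lpoint) : 'rV[R]_3 :=
  \row_(i < 3) [:: (xc q)%:R; (yc q)%:R; 1]`_i.

Definition in_relint_cone (V : {set lpoint}) (v : 'rV[int]_3) : Prop :=
  exists c : lpoint -> R, (forall q, q \in V -> 0 < c q) /\
    map_mx intr v = \sum_(q in V) c q *: lift1 q.

Section Fan.
(* the identification of the lattice of the fan with [Z^3] *)
Variable phi : {ffun edge -> int} -> 'rV[int]_3.

(* [M] is a point of the torus orbit of [M_theta] corresponding, under the
   orbit-cone correspondence, to the cone over the convex hull of [V] at height
   one: the one-parameter subgroups converging to a point of this orbit are
   those in the relative interior of the cone. *)
Definition in_orbit (theta : param) (V : {set lpoint}) (M : rep) : Prop :=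
  stable theta M /\
  forall d, cochar d ->
    (in_relint_cone V (phi d) <->
     exists2 M', same_orbit M M' & one_param_limit d M').

Definition in_fan (theta : param) (V : {set lpoint}) : Prop :=
  exists M, in_orbit theta V M.

Definition in_hull (V : {set lpoint}) (p : R * R) : Prop :=
  exists c : lpoint -> R,
    [/\ forall q, 0 <= c q, \sum_(q in V) c q = 1,
        p.1 = \sum_(q in V) c q * (xc q)%:R &
        p.2 = \sum_(q in V) c q * (yc q)%:R].

Definition elementary (T : {set lpoint}) : Prop :=
  exists p q r : lpoint, T = [set p; q; r]%SET /\
    `| ((xc q)%:Z - (xc p)%:Z) * ((yc r)%:Z - (yc p)%:Z)
       - ((xc r)%:Z - (xc p)%:Z) * ((yc q)%:Z - (yc p)%:Z) | = 1.

(* Triangulations of [Delta(a, b)] into elementary triangles, a triangle being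
   given by the set of its vertices. *)
Definition triangulation (D : {set {set lpoint}}) : Prop :=
  [/\ forall T, T \in D -> elementary T,
      forall p, in_hull [set: lpoint]%SET p -> exists2 T, T \in D & in_hull T p &
      forall T T', T \in D -> T' \in D -> forall p,
        in_hull T p -> in_hull T' p -> in_hull (T :&: T')%SET p].

(* The fan of [M_theta] consists of the cones over the cells of [D]. *)
Definition fan_of (theta : param) (D : {set {set lpoint}}) : Prop :=
  (forall M, stable theta M -> exists V, in_orbit theta V M) /\
  (forall V, in_fan theta V <-> exists2 T, T \in D & V \subset T).

(* The perfect matching [P^theta_q]. *)
Definition pmatch (theta : param) (q : lpoint) : {set edge} :=
  [set e | `[< exists2 M, in_orbit theta [set q]%SET M & M e = 0 >]]%SET.

Definition normalized_identification : Prop :=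
  [/\ forall d d', cochar d -> cochar d' -> phi (d + d') = phi d + phi d',
      forall d, cochar d -> (phi d = 0 <-> potential d),
      forall v, exists2 d, cochar d & phi d = v,
      forall theta, Theta theta -> generic theta ->
        exists2 D, triangulation D & fan_of theta D &
      forall theta, Theta theta -> generic theta -> forall j : 'I_n,
        (sgn pi j = -1 -> zig pi j \in pmatch theta (inl ord0) /\
                          zag pi j \in pmatch theta (inl ord_max)) /\
        (sgn pi j = 1 -> zag pi j \in pmatch theta (inr ord0) /\
                         zig pi j \in pmatch theta (inr ord_max))].

(** * Chambers and sequences of zigzag paths *)

(* On the segment from (0, 1/2) to (a, 1/2), the triangle [T] precedes [T']. *)
Definition crossed_before (T T' : {set lpoint}) : Prop :=
  forall x x' : R, in_hull T (x, 2^-1) -> in_hull T' (x', 2^-1) -> x <= x'.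

(* [T k] is the triangle of number [k + 1]. *)
Definition numbering (theta : param) (T : 'I_n -> {set lpoint}) : Prop :=
  exists D, [/\ triangulation D, fan_of theta D, injective T,
    forall t, t \in D <-> exists k, t = T k &
    forall k l : 'I_n, (k < l)%N -> crossed_before (T k) (T l)].

(* +1 if two vertices lie on the upper base, -1 otherwise; in the latter case,
   two vertices of an elementary triangle lie on the lower base. *)
Definition tri_sgn (T : {set lpoint}) : int :=
  if (1 < #|[set j : 'I_b.+1 | inr j \in T]%SET|)%N then 1 else -1.

Definition subsequence (omega : {perm 'I_n}) (s : int) : seq 'I_n :=
  [seq omega k | k <- enum 'I_n & sgn pi (omega k) == s].

Definition corresponds (theta : param) (omega : {perm 'I_n}) : Prop :=
  [/\ exists2 T, numbering theta T &
        forall k, sgn pi (omega k) = tri_sgn (T k),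
      forall i : 'I_a.+1, let z := subsequence omega (-1) in
        {subset [seq zag pi j | j <- take i z] <= pmatch theta (inl i)} /\
        {subset [seq zig pi j | j <- drop i z] <= pmatch theta (inl i)} &
      forall i : 'I_b.+1, let w := subsequence omega 1 in
        {subset [seq zig pi j | j <- take i w] <= pmatch theta (inr i)} /\
        {subset [seq zag pi j | j <- drop i w] <= pmatch theta (inr i)}].

Definition chamber_of (omega : {perm 'I_n}) (C : set param) : Prop :=
  chamber C /\ forall theta, C theta -> corresponds theta omega.

(* [M] is a point of the orbit of the cone [tau] over the intersection of the
   triangles of numbers [k] and [k']. *)
Definition in_tau (theta : param) (k k' : 'I_n) (M : rep) : Prop :=
  exists2 T, numbering theta T & in_orbit theta (T k :&: T k')%SET M.

End Fan.

(* Meant for [V] containing [zig j] or [zag j]. *)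
Definition SS (j : 'I_n) (V : {set edge}) : {set edge} :=
  if zig pi j \in V then (zag pi j |: (V :\ zig pi j))%SET
  else if zag pi j \in V then (zig pi j |: (V :\ zag pi j))%SET
  else V.

End Representations.

(* Main.v *)
(** A one-parameter subgroup converging to a stable representation is, up to a
    potential, given by nonnegative exponents on the arrows, and the support of
    the limit is their zero set.  By separatedness these exponents are additive
    on each cone, so a representation in the orbit of a cone vanishes on the
    perfect matchings of all its rays.  The two-dimensional cone [tau_(omega, k)]
    lies over the edge from (i, 0) to (j, 1), where i and j count the paths of
    sign -1 and +1 among the first [k] terms of the sequence; the matchings of
    its two rays kill one arrow on each line.  All the loops vanish too, and the
    other arrow of each line survives, as otherwise the support would be a tree
    and the orbit a fixed point.  Hence the surviving arrow of [u_(omega(m))]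
    depends only on its sign and on whether [m <= k], and swapping the positions
    [k] and [k + 1] flips exactly the lines [u_(omega(k))] and
    [u_(omega(k + 1))]. *)

Require Import Defs.
From HB Require Import structures.
From mathcomp Require Import all_boot all_order all_algebra all_fingroup.
From mathcomp Require Import boolp classical_sets reals.
From mathcomp Require Import complex.
From mathcomp Require Import zify ring lra.

Set Implicit Arguments.
Unset Strict Implicit.
Unset Printing Implicit Defensive.

Import Order.TTheory GRing.Theory Num.Theory.
Local Open Scope ring_scope.

(** * Preliminaries *)

Lemma fconnect_ordS n (i j : 'I_n) : fconnect (@ordS n) i j.
Proof.
have it d : val (iter d (@ordS n) i) = ((i + d) %% n)%N.
  elim: d => [|d IH] /=; first by rewrite addn0 modn_small.
  by rewrite IH -addn1 modnDml -addnA addn1.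
suff -> : j = iter (j + (n - i)) (@ordS n) i by exact: fconnect_iter.
apply: val_inj; rewrite it.
have -> : (i + (j + (n - i)) = j + n)%N by have := ltn_ord i; lia.
by rewrite modnDr modn_small.
Qed.

Lemma ordS_ind n (P : 'I_n -> Prop) (i : 'I_n) :
  P i -> (forall j, P j -> P (ordS j)) -> forall j, P j.
Proof.
move=> Pi PS j; have /iter_findex <- := fconnect_ordS i j.
by elim: (findex _ _ _) => //= d; apply: PS.
Qed.

(* The cycle ['I_n] cut between [j0] and [ordS j0] is a path, along which
   any recurrence can be solved. *)
Lemma cut_cycle_rec n (X : Type) (Q : X -> Prop) (j0 : 'I_n)
    (step : 'I_n -> X -> X) (x0 : X) :
  Q x0 -> (forall j x, j != j0 -> Q x -> Q (step j x)) ->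
  exists x : 'I_n -> X,
    (forall v, Q (x v)) /\ forall j, j != j0 -> x (ordS j) = step j (x j).
Proof.
move=> Q0 Qs; pose v0 := ordS j0.
pose y := fix y k := if k is k'.+1 then step (iter k' (@ordS n) v0) (y k') else x0.
have idx j : iter (findex (@ordS n) v0 j) (@ordS n) v0 = j.
  exact/iter_findex/fconnect_ordS.
have lt j : (findex (@ordS n) v0 j < fingraph.order (@ordS n) v0)%N.
  exact/findex_max/fconnect_ordS.
(* If [j] comes last, its successor is [v0 = ordS j0], which forces [j = j0]. *)
have fS j : j != j0 -> findex (@ordS n) v0 (ordS j) = (findex (@ordS n) v0 j).+1.
  move=> nj; have := lt j; rewrite leq_eqVlt => /orP[/eqP e|l].
    case/eqP: nj; apply: (@ordS_inj n).
    by rewrite -[RHS]/v0 -(iter_order (@ordS_inj n) v0) -e iterS idx.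
  by rewrite -{1}(idx j) -iterS findex_iter.
exists (fun v => y (findex (@ordS n) v0 v)); split => [v|j nj]; last first.
  by rewrite fS //= idx.
have: (findex (@ordS n) v0 v < fingraph.order (@ordS n) v0)%N by [].
elim: (findex _ _ _) => //= k IH lk; apply: Qs; last by apply: IH; lia.
apply/eqP => e; have := findex_iter lk.
by rewrite iterS e -/v0 findex0.
Qed.

(** Induction from the bottom gives [i <= f i], induction from the top [f i <= i]. *)
Lemma mono_ord_id n (f : 'I_n -> nat) :
  (forall i, (f i < n)%N) -> (forall i j : 'I_n, (i < j)%N -> (f i < f j)%N) ->
  forall i, f i = i.
Proof.
move=> fn fm.
have lo : forall m (i : 'I_n), i = m :> nat -> (m <= f i)%N.
  elim=> // m IH i ei; have lm : (m < n)%N by have := ltn_ord i; lia.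
  by have := IH (Ordinal lm) erefl; have := fm (Ordinal lm) i; rewrite /= ei; lia.
have hi : forall m (i : 'I_n), (i + m).+1 = n -> (f i <= i)%N.
  elim=> [|m IH] i ei; first by have := fn i; lia.
  have lm : (i.+1 < n)%N by lia.
  by have := IH (Ordinal lm); have := fm i (Ordinal lm); rewrite /=; lia.
move=> i; have := lo i i erefl; have := hi (n - i.+1)%N i.
by have := ltn_ord i; lia.
Qed.

(** * Polynomials agreeing with powers of the variable away from 0 *)

Section PolynomialPowers.
Variable F : numFieldType.
Implicit Types (p q : {poly F}).

(** In characteristic 0 the numbers 1, 2, 3, .. give more nonzero roots of [p - q] than its degree
    allows. *)
Lemma poly_eq_punctured p q :
  (forall t, t != 0 -> p.[t] = q.[t]) -> p = q.
Proof.
move=> pq; apply/eqP; rewrite -subr_eq0; apply/eqP.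
pose rs : seq F := [seq i.+1%:R | i <- iota 0 (size (p - q))].
apply: (@roots_geq_poly_eq0 _ _ rs); last by rewrite size_map size_iota.
  apply/allP => _ /mapP[i _ ->]; rewrite rootE hornerD hornerN subr_eq0.
  by rewrite pq // pnatr_eq0.
rewrite map_inj_uniq ?iota_uniq // => i j /eqP.
by rewrite eqr_nat => /eqP[].
Qed.

Lemma poly_eq_exprz p (z : int) :
  (forall t, t != 0 -> p.[t] = t ^ z) -> exists2 k : nat, z = k & p = 'X^k.
Proof.
case: z => k pz; first by exists k => //; apply: poly_eq_punctured => t /pz ->;
  rewrite hornerXn.
suff /(congr1 (horner^~ 0)) : p * 'X^(k.+1) = 1.
  by rewrite hornerM hornerXn exprS mul0r mulr0 hornerC => /esym/eqP;
     rewrite oner_eq0.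
apply: poly_eq_punctured => t t0.
by rewrite hornerM pz // hornerXn hornerC NegzE -exprnN mulVf // expf_neq0.
Qed.

Lemma mup0_root p : p != 0 -> (mup 0 p == 0%N) = (p.[0] != 0).
Proof. by move=> p0; rewrite -rootE -dvdp_XsubCl XsubC_dvd // -eqn0Ngt. Qed.

Lemma mup0_Xn k : mup 0 ('X^k : {poly F}) = k.
Proof. by rewrite -['X]subr0 mup_XsubCX eqxx. Qed.

Lemma mup_prod (I : finType) (P : I -> {poly F}) :
  (forall i, P i != 0) -> mup 0 (\prod_i P i) = (\sum_i mup 0 (P i))%N.
Proof.
move=> P0; suff [] : \prod_i P i != 0 /\ mup 0 (\prod_i P i) = (\sum_i mup 0 (P i))%N by [].
apply: (big_ind2 (fun p k => p != 0 /\ mup 0 p = k)) => [|p k q l [p0 <-] [q0 <-]|i _].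
- by rewrite oner_eq0 mupNroot // rootC oner_eq0.
- by rewrite mulf_neq0 // mupM.
- by rewrite P0.
Qed.

End PolynomialPowers.

(** * Cocharacters *)

Section Quiver.
Variables (a b : nat) (pi : {perm 'I_(a + b)}).
Local Notation n := (a + b)%N.
Local Notation edge := (edge pi).
Local Notation zig := (zig pi).
Local Notation zag := (zag pi).
Local Notation sgn := (sgn pi).
Local Notation star_R := (star_R pi).
Local Notation star_L := (star_L pi).
Local Notation head := (@Defs.head a b pi).
Local Notation tail := (@Defs.tail a b pi).
Implicit Types (j f v : 'I_n) (e : edge) (d m : {ffun edge -> int}).

(** The two arrows of a line sorted by direction, rightward being from the face [j] to [ordS j];
    which one is the zig depends on the sign. *)
Definition rightward j : edge := inl (j, sgn j == 1).
Definition leftward j : edge := inl (j, sgn j != 1).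

Lemma head_rightward j : head (rightward j) = ordS j.
Proof. by rewrite /= /left_to_right eqxx. Qed.

Lemma tail_rightward j : tail (rightward j) = j.
Proof. by rewrite /= /left_to_right eqxx. Qed.

Lemma head_leftward j : head (leftward j) = j.
Proof. by rewrite /= /left_to_right; case: (sgn j == 1). Qed.

Lemma tail_leftward j : tail (leftward j) = ordS j.
Proof. by rewrite /= /left_to_right; case: (sgn j == 1). Qed.

Lemma edge_cases (P : edge -> Prop) :
  (forall j, P (rightward j)) -> (forall j, P (leftward j)) ->
  (forall h, P (inr h)) -> forall e, P e.
Proof.
move=> Pr Pl Ph [[j z]|h] //; have := Pr j; have := Pl j.
by rewrite /rightward /leftward; case: (sgn j == 1); case: z.
Qed.

Lemma sgn_cases j : sgn j = 1 \/ sgn j = -1.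
Proof. by rewrite /Defs.sgn; case: ifP; [right|left]. Qed.

Lemma zig_zag_sum (V : nmodType) (g : edge -> V) j :
  g (zig j) + g (zag j) = g (rightward j) + g (leftward j).
Proof. by rewrite /rightward /leftward; case: (sgn j == 1); rewrite // addrC. Qed.

(** * Cycles around the nodes *)

Lemma star_R_line f : zig (ord_pred f) \in star_R f /\ zag (ord_pred f) \in star_R f.
Proof.
by rewrite /Defs.star_R; case: insub => [h|]; rewrite /star_rhombus !inE !eqxx ?orbT.
Qed.

Lemma star_L_line f : zig f \in star_L f /\ zag f \in star_L f.
Proof.
by rewrite /Defs.star_L; case: insub => [h|]; rewrite /star_rhombus !inE !eqxx ?orbT.
Qed.

Lemma mem_white_star e : e \in white_star e.
Proof.
rewrite /white_star; case: e => [[j z]|h] /=; last first.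
  by rewrite /Defs.star_R /Defs.star_L valK; case: ifP => _; rewrite !inE eqxx ?orbT.
case: ifP => _; first by have := star_R_line (ordS j); rewrite ordSK => -[]; case: z.
by have := star_L_line j => -[]; case: z.
Qed.

Lemma mem_black_star e : e \in black_star e.
Proof.
rewrite /black_star; case: e => [[j z]|h] /=; last first.
  by rewrite /Defs.star_R /Defs.star_L valK; case: ifP => _; rewrite !inE eqxx ?orbT.
case: ifP => _; last by have := star_R_line (ordS j); rewrite ordSK => -[]; case: z.
by have := star_L_line j => -[]; case: z.
Qed.

Lemma rest_of_cycle_perm e (c : seq edge) :
  e \in c -> perm_eq c (e :: rest_of_cycle e c).
Proof.
move=> ec; rewrite /rest_of_cycle.
have: perm_eq c (rot (index e c) c) by rewrite perm_sym perm_rot.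
by rewrite /rot drop_index.
Qed.

Lemma gamma_plus_perm e : perm_eq (white_star e) (e :: gamma_plus e).
Proof.
rewrite /gamma_plus; apply: perm_trans (rest_of_cycle_perm _).
  by rewrite perm_sym perm_rev.
by rewrite mem_rev mem_white_star.
Qed.

Lemma gamma_minus_perm e : perm_eq (black_star e) (e :: gamma_minus e).
Proof. exact/rest_of_cycle_perm/mem_black_star. Qed.

Lemma sum_star_R (V : nmodType) (g : edge -> V) f :
  \sum_(x <- star_R f) g x = (g (zig (ord_pred f)) + g (zag (ord_pred f))) +
    (if insub f is Some h then g (inr h) else g (zig f) + g (zag f)).
Proof.
rewrite /Defs.star_R; case: insub => [h|]; rewrite !big_cons big_nil addr0.
  by rewrite addrA.
by rewrite [RHS]addrC !addrA.
Qed.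

Lemma sum_star_L (V : nmodType) (g : edge -> V) f :
  \sum_(x <- star_L f) g x = (g (zig f) + g (zag f)) +
    (if insub f is Some h then g (inr h)
     else g (zig (ord_pred f)) + g (zag (ord_pred f))).
Proof.
by rewrite /Defs.star_L; case: insub => [h|]; rewrite !big_cons big_nil addr0 !addrA.
Qed.

(** Adding the value at [e] closes both paths to full cycles around the nodes of [e]. *)
Lemma cocharP d : cochar d <->
  forall e, \sum_(x <- white_star e) d x = \sum_(x <- black_star e) d x.
Proof.
split=> cd e.
  by rewrite (perm_big _ (gamma_plus_perm e)) (perm_big _ (gamma_minus_perm e))
    !big_cons cd.
apply: (@addrI _ (d e)).
by have := cd e; rewrite (perm_big _ (gamma_plus_perm e))
  (perm_big _ (gamma_minus_perm e)) !big_cons.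
Qed.

Lemma potential_cochar d : potential d -> cochar d.
Proof.
move=> [eta de]; have d0 j : d (zig j) + d (zag j) = 0.
  by rewrite zig_zag_sum !de head_rightward tail_rightward head_leftward
    tail_leftward addrC subrKA subrr.
have dh h : d (inr h) = 0 by rewrite de subrr.
apply/cocharP => e; rewrite /white_star /black_star.
by case: ifP => _; rewrite sum_star_L sum_star_R !d0 !add0r;
  do 2 (case: insub => [?|]; rewrite ?dh).
Qed.

(** The 2-cycles across the lines, the loops and the cycle through all the strips generate the
    cycles of the quiver, so [d] can be integrated. *)
Lemma potentialP d : (forall j, d (zig j) + d (zag j) = 0) ->
  (forall h, d (inr h) = 0) -> \sum_j d (rightward j) = 0 -> potential d.
Proof.
move=> d0 dh ds.
have [j0|noj] := pickP (mem [set: 'I_n]); last first.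
  exists (fun=> 0); apply: edge_cases => [j|j|h]; last by rewrite dh subrr.
    by have := noj j; rewrite /= inE.
  by have := noj j; rewrite /= inE.
move=> _; have [|eta [_ etaS]] := @cut_cycle_rec n int (fun=> True) j0
  (fun j x => x + d (rightward j)) 0 I; first by [].
(* At the cut [j0] the formula comes from the vanishing of the total sum. *)
have etar j : d (rightward j) = eta (ordS j) - eta j.
  have [->|/etaS ->] := eqVneq j j0; last by rewrite addrC addKr.
  have: \sum_j (eta (ordS j) - eta j) = \sum_j d (rightward j).
    by rewrite ds sumrB [X in _ - X](reindex_inj (@ordS_inj n)) subrr.
  rewrite (bigD1 j0) //= [RHS](bigD1 j0) //=.
  rewrite (eq_bigr (fun j => d (rightward j))); last first.
    by move=> i /etaS ->; rewrite addrC addKr.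
  by move/addIr.
exists eta; apply: edge_cases => [j|j|h]; last by rewrite dh subrr.
  by rewrite etar head_rightward tail_rightward.
rewrite head_leftward tail_leftward -opprB -etar.
by apply/eqP; rewrite -addr_eq0 addrC -zig_zag_sum d0.
Qed.

Lemma cocharD d d' : cochar d -> cochar d' -> cochar (d + d').
Proof.
move=> cd cd' e; rewrite (eq_bigr _ (fun x _ => ffunE _ x)) big_split cd cd' -big_split.
by apply: eq_bigr => x _; rewrite ffunE.
Qed.

Lemma cocharN d : cochar d -> cochar (- d).
Proof.
move=> cd e; rewrite (eq_bigr _ (fun x _ => ffunE _ x)) sumrN cd -sumrN.
by apply: eq_bigr => x _; rewrite ffunE.
Qed.

Lemma cochar0 : cochar (0 : {ffun edge -> int}).
Proof. by move=> e; rewrite !big1 // => x _; rewrite ffunE. Qed.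

Lemma cocharMn d k : cochar d -> cochar (d *+ k).
Proof.
by move=> cd; elim: k => [|k IH]; [exact: cochar0 | rewrite mulrS; exact: cocharD].
Qed.

(** The nodes of a line are joined by edges, and the nodes facing each other across a strip coincide
    or are joined by a horizontal edge. *)
Lemma cochar_degree d : cochar d ->
  exists K, forall f, \sum_(x <- star_R f) d x = K /\ \sum_(x <- star_L f) d x = K.
Proof.
move=> /cocharP cd; have LR f : \sum_(x <- star_L f) d x = \sum_(x <- star_R f) d x.
  have := sum_star_L d f; have := sum_star_R d f.
  case: insubP => [h _ vh|_ -> ->]; last exact: addrC.
  have := cd (inr h); rewrite /white_star /black_star.
  by case: ifP => _; rewrite /strip_left /strip_right vh.
have RL j : \sum_(x <- star_R (ordS j)) d x = \sum_(x <- star_L j) d x.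
  by have := cd (zig j); rewrite /white_star /black_star /=; case: ifP.
have [f0|nof] := pickP (mem [set: 'I_n]); last first.
  by exists 0 => f; have := nof f; rewrite /= inE.
move=> _; exists (\sum_(x <- star_L f0) d x); apply: (ordS_ind (i := f0)).
  by rewrite LR.
by move=> j [_ <-]; rewrite (LR (ordS j)) RL.
Qed.

(** With [K] the sum around any node, the sum [p] over a line becomes [K - p] across rhombi and is
    unchanged across hexagons. So it depends only on the sign, and the loop has the value
    [K - p (val h)]. *)
Lemma cochar_loop d (h : {f | hexagonal pi f}) j : cochar d -> sgn j != sgn (val h) ->
  d (inr h) = d (zig j) + d (zag j).
Proof.
move=> /cochar_degree[K dK] sj; pose p := fun i => d (zig i) + d (zag i).
have pS i : p (ordS i) = if sgn (ordS i) == sgn i then p i else K - p i.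
  have [KR KL] := dK (ordS i); move: KR KL; rewrite sum_star_R sum_star_L ordSK -!/(p _).
  case: insubP => [h' + _|]; rewrite /hexagonal ordSK eq_sym.
    by move=> -> <- /addIr.
  by move=> /negbTE -> _ <-; rewrite addrK.
have pK i : p i = if sgn i == sgn (val h) then p (val h) else K - p (val h).
  move: i; apply: (ordS_ind (i := val h)) => [|i IH]; first by rewrite eqxx.
  rewrite pS IH; case: (sgn_cases (ordS i)) => ->; case: (sgn_cases i) => ->;
    case: (sgn_cases (val h)) => -> //=; lia.
have [_] := dK (val h); rewrite sum_star_L valK -/(p _) -/(p _) => e.
by rewrite -[RHS]/(p j) pK (negbTE sj) -e -/(p _) addrAC subrr add0r.
Qed.

End Quiver.

(** * Limits and torus orbits *)

Section Limits.
Variables (R : realType) (a b : nat) (pi : {perm 'I_(a + b)}).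
Local Notation n := (a + b)%N.
Local Notation edge := (edge pi).
Local Notation zig := (zig pi).
Local Notation zag := (zag pi).
Local Notation sgn := (sgn pi).
Local Notation head := (@Defs.head a b pi).
Local Notation tail := (@Defs.tail a b pi).
Local Notation rep := (rep R pi).
Local Notation lpoint := (lpoint a b).
Local Notation in_orbit := Defs.in_orbit.
Implicit Types (j f v : 'I_n) (e : edge) (d m : {ffun edge -> int}) (M : rep).

Definition zeros m : {set edge} := [set e | m e == 0].

Lemma iso_eq0 (M M' : edge -> R[i]) e : iso M M' -> (M' e == 0) = (M e == 0).
Proof.
move=> [g [g0 ->]].
by rewrite !mulf_eq0 invr_eq0 (negbTE (g0 _)) (negbTE (g0 _)) orbF.
Qed.

Lemma same_orbit_Supp M M' : same_orbit M M' -> Supp M' = Supp M.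
Proof.
move=> [t [_ t0 /iso_eq0 tM]]; apply/setP => e.
by rewrite !inE tM mulf_eq0 (negbTE (t0 e)).
Qed.

(** Loops, the product of the two arrows of a line and the product of all rightward arrows are gauge
    invariant, so they are monomials on the family [F]. The orders of vanishing [m] at 0 thus agree
    with [d] on these cycles. *)
Lemma limit_exponents d M : one_param_limit d M ->
  exists m, [/\ forall e, 0 <= m e, potential (m - d) & Supp M = zeros m].
Proof.
move=> [F [Ft F0]].
have loop h : exists2 k : nat, d (inr h) = k & F (inr h) = 'X^k.
  apply: poly_eq_exprz => t /Ft[g [g0 ->]].
  by rewrite mulrAC mulfV ?mul1r.
have gen (K : fieldType) (x y s t : K) : x != 0 -> y != 0 ->
    x * s / y * (y * t / x) = s * t by move=> x0 y0; field; rewrite x0 y0.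
have line j : exists2 k : nat, d (zig j) + d (zag j) = k & F (zig j) * F (zag j) = 'X^k.
  apply: poly_eq_exprz => t t0; have [g [g0 Fg]] := Ft t t0.
  rewrite (zig_zag_sum d) expfzDr // hornerM.
  have -> : (F (zig j)).[t] * (F (zag j)).[t] =
      (F (rightward pi j)).[t] * (F (leftward pi j)).[t].
    by rewrite /rightward /leftward; case: (sgn j == 1); rewrite // mulrC.
  rewrite !Fg head_rightward tail_rightward head_leftward tail_leftward.
  exact: gen.
have cyc : exists2 k : nat, \sum_j d (rightward pi j) = k &
    \prod_j F (rightward pi j) = 'X^k.
  apply: poly_eq_exprz => t t0; have [g [g0 Fg]] := Ft t t0.
  have -> : (\prod_j F (rightward pi j)).[t] = (\prod_j g (ordS j) / \prod_j g j) *
      \prod_j t ^ d (rightward pi j).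
    rewrite horner_prod -prodf_div -big_split; apply: eq_bigr => j _.
    by rewrite Fg head_rightward tail_rightward mulrAC.
  rewrite [\prod_j g j](reindex_inj (@ordS_inj n)) /= mulfV ?mul1r; last by apply/prodf_neq0.
  by elim/big_rec2: _ => [|j z p _ ->]; rewrite ?expr0z // expfzDr.
have Fn0 e : F e != 0.
  case: e => [[j z]|h]; last by have [k _ ->] := loop h; rewrite monic_neq0 ?monicXn.
  have [k _ Fj] := line j; have := monic_neq0 (monicXn R[i] k).
  by rewrite -Fj mulf_eq0 negb_or => /andP[]; case: z.
pose m := [ffun e => (mup 0 (F e))%:Z].
exists m; split => [e||]; first by rewrite ffunE.
  apply: potentialP => [j|h|].
  - have [k dk Fk] := line j; rewrite !ffunE addrACA -opprD dk.
    by rewrite -PoszD -mupM // Fk mup0_Xn subrr.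
  - by have [k dk Fk] := loop h; rewrite !ffunE dk Fk mup0_Xn subrr.
  - have [k dk Fk] := cyc.
    rewrite (eq_bigr (fun j => m (rightward pi j) - d (rightward pi j))); last first.
      by move=> j _; rewrite !ffunE.
    rewrite sumrB dk -(mup0_Xn R[i] k) -Fk mup_prod//.
    rewrite (big_morph Posz PoszD (erefl (Posz 0))) -sumrB big1 // => j _.
    by rewrite ffunE subrr.
apply/setP => e; rewrite !inE ffunE (iso_eq0 e F0).
by rewrite -mup0_root.
Qed.

Lemma indicator_limit m : (forall e, 0 <= m e) ->
  one_param_limit m [ffun e => (m e == 0)%:R : R[i]].
Proof.
move=> m0; exists (fun e => 'X^(`|m e|%N)); split=> [t t0|].
  exists (fun=> 1); split=> [v|e]; first exact: oner_neq0.
  by rewrite hornerXn invr1 mulr1 mul1r -{2}(gez0_abs (m0 e)).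
exists (fun=> 1); split=> [v|e]; first exact: oner_neq0.
by rewrite ffunE hornerXn invr1 mulr1 mul1r expr0n absz_eq0.
Qed.

(** If [eta] took two values, a superlevel set would be a subrepresentation of [M1] and its
    complement one of [M2], both of positive weight, although the weights add up to 0. For [M1 = M2]
    this expresses connectedness of the support, in general separatedness. *)
Lemma stable_monotone_const (theta : param R a b) M1 M2 (eta : 'I_n -> int) :
  Theta theta -> stable theta M1 -> stable theta M2 ->
  (forall e, M1 e != 0 -> eta (tail e) <= eta (head e)) ->
  (forall e, M2 e != 0 -> eta (head e) <= eta (tail e)) ->
  forall u v, eta u = eta v.
Proof.
move=> th [_ st1] [_ st2] up down.
suff le u v : eta v <= eta u by move=> u v; apply/eqP; rewrite eq_le !le.
rewrite leNgt; apply/negP => uv.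
pose N := [set w | eta v <= eta w].
have uN : u \notin N by rewrite inE -ltNge.
have vN : v \in N by rewrite inE.
have w1 : 0 < weight theta N.
  apply: st1; first by move=> e /up te; rewrite !inE => /le_trans; apply.
    by apply/set0Pn; exists v.
  by apply: contraNneq uN => ->; rewrite inE.
have w2 : 0 < weight theta (~: N).
  apply: st2.
  - by move=> e /down te; rewrite !inE -!ltNge; apply: le_lt_trans.
  - by apply/set0Pn; exists u; rewrite inE.
  - by apply/eqP => /setP /(_ v); rewrite !inE lexx.
suff : weight theta N + weight theta (~: N) = 0 by move: (addr_gt0 w1 w2) => /[swap] ->;
  rewrite ltxx.
rewrite -[RHS]th /weight [RHS](bigID (mem N)) /=; congr (_ + _).
by apply: eq_bigl => w; rewrite !inE.
Qed.

(** * Exponents attached to the cone of an orbit *)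

Section Identification.
Variable phi : {ffun edge -> int} -> 'rV[int]_3.
Hypothesis phiD : forall d d', cochar d -> cochar d' -> phi (d + d') = phi d + phi d'.
Hypothesis phi0 : forall d, cochar d -> (phi d = 0 <-> potential d).
Hypothesis phi_surj : forall z, exists2 d, cochar d & phi d = z.

Lemma phi_eq d d' : cochar d -> cochar d' -> phi d = phi d' -> potential (d - d').
Proof.
move=> cd cd' pd; have cB := cocharD cd (cocharN cd').
by apply/(phi0 cB)/(@addrI _ (phi d')); rewrite -phiD // addrC subrK addr0.
Qed.

Lemma phiMn d k : cochar d -> phi (d *+ k) = phi d *+ k.
Proof.
move=> cd; elim: k => [|k IH]; last by rewrite !mulrS phiD ?IH //; exact: cocharMn.
by apply/phi0; [exact: cochar0|exists (fun=> 0) => e; rewrite ffunE subrr].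
Qed.

Lemma phi_potential d d' : cochar d -> potential (d' - d) -> cochar d' /\ phi d' = phi d.
Proof.
move=> cd pd; have cp := potential_cochar pd.
by rewrite -(subrK d d') phiD // (proj2 (phi0 cp) pd) add0r; split => //; exact: cocharD.
Qed.

(** A cocharacter over [z] converges to the orbit; changing it by a potential makes it
    nonnegative. *)
Lemma orbit_exponents theta (V : {set lpoint}) M (z : 'rV[int]_3) :
  in_orbit phi theta V M -> in_relint_cone R V z ->
  exists m, [/\ forall e, 0 <= m e, cochar m, phi m = z & Supp M = zeros m].
Proof.
move=> [_ orb] Vz; have [d cd dz] := phi_surj z.
have := Vz; rewrite -dz => /(orb d cd)[M' /same_orbit_Supp <- /limit_exponents].
by move=> [m [m0 /(phi_potential cd)[cm <-] ->]]; exists m.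
Qed.

Definition lift_int (q : lpoint) : 'rV[int]_3 :=
  \row_(i < 3) [:: (xc q)%:Z; (yc q)%:Z; 1]`_i.

Lemma lift_intE q : map_mx intr (lift_int q) = lift1 R q.
Proof.
apply/rowP => i; rewrite !mxE.
by case: i => [[|[|[|i]]] ?] //=; rewrite ?rmorph1 -?pmulrn.
Qed.

Lemma relint_cone_sum (V : {set lpoint}) (c : lpoint -> nat) :
  in_relint_cone R V (\sum_(q in V) lift_int q *+ (c q).+1).
Proof.
exists (fun q => (c q).+1%:R); split=> [q _|]; first by rewrite ltr0n.
rewrite (raddf_sum (@map_mx _ _ (intr : int -> R) 1 3)); apply: eq_bigr => q _.
by rewrite -lift_intE scaler_nat raddfMn.
Qed.

(* If [m N] converges to the orbit of [M] and [phi (m N) = phi (m 0) + N q],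
   then [m 1 - m 0] is nonnegative and vanishes on the support of [M], so that
   by separatedness it is the exponent of the orbit of the ray [q]. *)
Lemma pmatch_vanish theta (V : {set lpoint}) M q e : Theta theta ->
  in_orbit phi theta V M -> q \in V -> e \in pmatch phi theta q -> M e = 0.
Proof.
move=> th orb qV; rewrite inE => /asboolP[Mq orbq Mqe].
have stM := orb.1; have stq := orbq.1.
pose w N := \sum_(p in V) lift_int p *+ (if p == q then N else 0%N).+1.
have wS N : w N.+1 = w N + lift_int q.
  rewrite /w (bigD1 q) //= [X in _ = X + _](bigD1 q) //= eqxx mulrSr addrAC.
  by congr (_ + _ + _); apply: eq_bigr => p /andP[_ /negbTE ->].
have ex N : exists m, [/\ forall x, 0 <= m x, cochar m, phi m = w N & Supp M = zeros m].
  exact/(orbit_exponents orb)/relint_cone_sum.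
have [m0 [m0_ge0 cm0 phim0 SM0]] := ex 0%N; have [m1 [m1_ge0 cm1 phim1 SM1]] := ex 1%N.
have Mz m : Supp M = zeros m -> forall x, M x != 0 -> m x = 0.
  by move=> /setP SM x Mx; have := SM x; rewrite !inE Mx => /esym/eqP.
pose mu := m1 - m0.
have phimu : phi mu = lift_int q.
  have := phim1; rewrite wS -phim0 -(subrK m0 m1) -/mu phiD //; last first.
    exact: cocharD (cocharN _).
  by rewrite addrC => /addrI.
have cmu : cochar mu by exact: cocharD (cocharN _).
(* Hence exponents vanishing on the support of [M] are determined by their image under [phi]; those
   over [w N] are [m0 + mu *+ N]. *)
have pot0 d : potential d -> (forall x, M x != 0 -> d x = 0) -> d = 0.
  move=> [eta deta] dz; apply/ffunP => x; rewrite ffunE deta; apply/eqP.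
  rewrite subr_eq0; apply/eqP/(stable_monotone_const th stM stM) => y My;
    by have /eqP := dz y My; rewrite deta subr_eq0 => /eqP ->.
have mN N : forall x, 0 <= (m0 + mu *+ N) x.
  have [m [m_ge0 cm phim SM]] := ex N; suff <- : m = m0 + mu *+ N by [].
  apply/eqP; rewrite -subr_eq0; apply/eqP/pot0.
    apply: phi_eq => //; first exact: cocharD (cocharMn _ _).
    rewrite phim phiD ?phiMn //; last exact: cocharMn.
    rewrite phim0 phimu; elim: (N) => [|k IH]; first by rewrite addr0.
    by rewrite wS IH mulrSr addrA.
  move=> x Mx; rewrite !ffunE ffunMnE !ffunE.
  by rewrite (Mz _ SM x Mx) (Mz _ SM0 x Mx) (Mz _ SM1 x Mx) oppr0 addr0 mul0rn addr0.
have mu_ge0 x : 0 <= mu x.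
  (* A negative [mu x] would outweigh [m0 x] after [|m0 x| + 1] steps. *)
  rewrite leNgt; apply/negP => mux.
  move: mux (m0_ge0 x) (mN (`|m0 x|%N.+1) x); clearbody mu.
  rewrite ffunE ffunMnE -mulr_natr natz.
  by move: (mu x) (m0 x) => y z; nia.
have muM x : M x != 0 -> mu x = 0.
  by move=> Mx; rewrite !ffunE (Mz _ SM0 x Mx) (Mz _ SM1 x Mx) subrr.
have [mq [mq_ge0 cmq phimq SMq]] : exists m,
    [/\ forall x, 0 <= m x, cochar m, phi m = lift_int q & Supp Mq = zeros m].
  apply: (orbit_exponents orbq); have := relint_cone_sum [set q] (fun=> 0%N).
  by rewrite big_set1 mulr1n.
have Mqz x : (Mq x == 0) = (mq x != 0).
  by have /setP/(_ x) := SMq; rewrite !inE => <-; rewrite negbK.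
have [eta Deta] : potential (mu - mq) by apply: phi_eq; rewrite // phimu phimq.
(* Weakly, [eta] increases along the support of [Mq], where [mq] is 0, and decreases along that of
   [M], where [mu] is 0. So [mu = mq]. *)
have /(_ _ _) eta_c : forall u v, eta u = eta v.
  apply: (stable_monotone_const th stq stM) => x.
    rewrite Mqz negbK -subr_ge0 -Deta !ffunE => /eqP ->.
    by have := mu_ge0 x; rewrite !ffunE oppr0 addr0.
  move=> Mx; rewrite -subr_le0 -Deta; have := muM x Mx; rewrite !ffunE => ->.
  by rewrite add0r oppr_le0.
apply/eqP/negPn/negP => Me.
have := Deta e; rewrite (eta_c (tail e) (head e)) subrr ffunE (muM e Me) add0r ffunE.
by move/eqP; rewrite oppr_eq0; apply/negP; rewrite -Mqz Mqe.
Qed.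

(* The linear form vanishing at (i, 0, 1) and (j, 1, 1). *)
Definition edge_form (i j : nat) (z : 'rV[int]_3) : int :=
  z 0 0 - i%:Z * (z 0 ord_max - z 0 1) - j%:Z * z 0 1.

Lemma edge_formD (i j : nat) y z : edge_form i j (y + z) = edge_form i j y + edge_form i j z.
Proof. by rewrite /edge_form !mxE; ring. Qed.

Lemma edge_formMn (i j : nat) z k : edge_form i j (z *+ k) = edge_form i j z *+ k.
Proof.
elim: k => [|k IH]; last by rewrite !mulrS edge_formD IH.
by rewrite /edge_form !mxE !mulr0n; ring.
Qed.

Lemma relint_edge_form (i : 'I_a.+1) (j : 'I_b.+1) z :
  in_relint_cone R ([set inl i; inr j] : {set lpoint}) z -> edge_form i j z = 0.
Proof.
move=> [c [_ /rowP zc]]; apply/eqP; rewrite -(intr_eq0 R); apply/eqP.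
have zE k : (z 0 k)%:~R = c (inl i) * [:: i%:R; 0; 1]`_k + c (inr j) * [:: j%:R; 1; 1]`_k.
  have := zc k; rewrite mxE => ->; rewrite big_setU1 ?inE //= big_set1 !mxE.
  by rewrite mulr0n mulr1n.
rewrite /edge_form !(rmorphB, rmorphM) /= !zE /= -!pmulrn.
by ring.
Qed.

(* If no arrow of the line [l0] acted by a nonzero scalar, the support of [M]
   would be a tree; the orbit of [M] would then be a fixed point of the torus,
   and the cone over [V] would be 3-dimensional. *)
Lemma edge_orbit_line theta (i : 'I_a.+1) (j : 'I_b.+1) M l0 :
  Theta theta -> in_orbit phi theta [set inl i; inr j] M ->
  (forall l, M (zig l) = 0 \/ M (zag l) = 0) -> (forall h, M (inr h) = 0) ->
  M (zig l0) != 0 \/ M (zag l0) != 0.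
Proof.
move=> th orb Mline Mloop; have stM := orb.1.
apply/orP; rewrite -negb_and; apply/negP => /andP[/eqP zig0 /eqP zag0].
have noM l : M (zig l) = 0 -> M (zag l) = 0 ->
    M (rightward pi l) = 0 /\ M (leftward pi l) = 0.
  by rewrite /rightward /leftward; case: (sgn l == 1).
have Mrl l : M (rightward pi l) != 0 -> M (leftward pi l) = 0.
  have := Mline l; rewrite /rightward /leftward /Defs.zig /Defs.zag.
  by case: (sgn l == 1) => -[->|->] //; rewrite eqxx.
have [r0 l00] := noM _ zig0 zag0.
(* If [l] were dead too, a function jumping at [l] would be constant along the support, against
   stability. *)
have full l : l != l0 -> M (rightward pi l) = 0 -> M (leftward pi l) != 0.
  move=> nl Mr; apply/eqP => Ml.
  have [//|eta [_ etaS]] := @cut_cycle_rec _ int (fun=> True) l0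
    (fun v x => x + (v == l)%:R) 0 I.
  have etaM e : M e != 0 -> eta (tail e) = eta (head e).
    move: e; apply: edge_cases => [v|v|h] //.
      rewrite tail_rightward head_rightward => Mv.
      have nv : v != l0 by apply: contraNneq Mv => ->; rewrite r0.
      rewrite etaS //; case: eqP => [e|]; last by rewrite addr0.
      by rewrite e Mr eqxx in Mv.
    rewrite tail_leftward head_leftward => Mv.
    have nv : v != l0 by apply: contraNneq Mv => ->; rewrite l00.
    rewrite etaS //; case: eqP => [e|]; last by rewrite addr0.
    by rewrite e Ml eqxx in Mv.
  have : eta (ordS l) = eta l.
    by apply: (stable_monotone_const th stM stM) => e /etaM ->.
  by rewrite etaS // eqxx; lia.
(* Solving for the gauge from strip to strip, starting after the cut [l0], turns all nonzero scalars
   into 1. *)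
have gauge : same_orbit M [ffun e => (M e != 0)%:R].
  exists [ffun=> 1]; split=> [e|e|]; first by rewrite !big1 // => x _; rewrite ffunE.
    by rewrite ffunE oner_neq0.
  have [|v x nv x0|g [g0 gS]] := @cut_cycle_rec _ R[i] (fun x => x != 0) l0
    (fun v x => if M (rightward pi v) == 0 then x * M (leftward pi v)
                else x / M (rightward pi v)) 1; first exact: oner_neq0.
    case: ifP => Mv; first by rewrite mulf_neq0 // full //; apply/eqP.
    by rewrite mulf_neq0 // invr_eq0 Mv.
  exists g; split=> // e; rewrite !ffunE mul1r; have [->|] := eqVneq (M e) 0.
    by rewrite mulr0 mul0r.
  move: e; apply: edge_cases => [v|v|h] //; last by rewrite Mloop eqxx.
    rewrite tail_rightward head_rightward => Mv.
    have nv : v != l0 by apply: contraNneq Mv => ->; rewrite r0.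
    by rewrite gS // (negbTE Mv) mulfVK // mulfV.
  rewrite tail_leftward head_leftward => Mv.
  have nv : v != l0 by apply: contraNneq Mv => ->; rewrite l00.
  have Mr : M (rightward pi v) = 0 by apply: contraNeq Mv => /Mrl ->.
  by rewrite gS // Mr eqxx mulfV // mulf_neq0.
(* This direction leaves the plane of the cone: [edge_form] is 1 on it. Next, a potential cancels
   [d] on the support. *)
have [d cd phid] := phi_surj (delta_mx 0 0).
have [//|eta [_ etaS]] := @cut_cycle_rec _ int (fun=> True) l0
  (fun v x => if M (rightward pi v) == 0 then x + d (leftward pi v)
              else x - d (rightward pi v)) 0 I.
pose mu := [ffun e => d e + eta (head e) - eta (tail e)].
have pmu : potential (mu - d) by exists eta => e; rewrite !ffunE; ring.
have [cmu phimu] := phi_potential cd pmu.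
have mu0 e : M e != 0 -> mu e = 0.
  rewrite ffunE; move: e; apply: edge_cases => [v|v|h]; last by rewrite Mloop eqxx.
    rewrite tail_rightward head_rightward => Mv.
    have nv : v != l0 by apply: contraNneq Mv => ->; rewrite r0.
    by rewrite etaS // (negbTE Mv); ring.
  rewrite tail_leftward head_leftward => Mv.
  have nv : v != l0 by apply: contraNneq Mv => ->; rewrite l00.
  have Mr : M (rightward pi v) = 0 by apply: contraNeq Mv => /Mrl ->.
  by rewrite etaS // Mr eqxx; ring.
have relz := relint_cone_sum [set inl i; inr j] (fun=> 0%N).
have [m [m_ge0 cm phim SM]] := orbit_exponents orb relz.
(* This multiple of [m] outweighs [mu] off the support, so [m'] vanishes exactly on the support and
   its limit lies in the orbit, although [edge_form] is 1 on [phi m']. *)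
pose N := (\sum_e `|mu e|).+1%N.
pose m' := m *+ N + mu.
have cm' : cochar m' by apply: cocharD cmu; exact: cocharMn.
have m'E e : (M e != 0 -> m' e = 0) /\ (M e = 0 -> 0 < m' e).
  have := congr1 (fun S : {set edge} => e \in S) SM; rewrite !inE => Me.
  rewrite ffunE ffunMnE; split=> [nM|M0].
    by have /eqP -> : m e == 0; rewrite -?Me // mu0 // mul0rn addr0.
  have mpos : 0 < m e by rewrite lt_def -Me M0 eqxx m_ge0.
  have muN : (`|mu e| < N)%N by rewrite ltnS (bigD1 e) //= leq_addr.
  rewrite -mulr_natr natz; suff: forall (y z : int) (k : nat),
    0 < z -> (`|y| < k)%N -> 0 < z * k + y by apply.
  by move=> y z k; nia.
have := orb.2 _ cm'; case=> _ /(_ _) H.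
have /relint_edge_form : in_relint_cone R ([set inl i; inr j] : {set lpoint}) (phi m').
  apply/H; exists [ffun e => (M e != 0)%:R] => //.
  have -> : [ffun e => (M e != 0)%:R] = [ffun e => (m' e == 0)%:R] :> rep.
    apply/ffunP => e; rewrite [LHS]ffunE [RHS]ffunE; have [M0 M1] := m'E e.
    by have [/M1/gt_eqF ->|/M0 ->] := eqVneq (M e) 0; rewrite ?eqxx.
  apply: indicator_limit => e; have [M0 M1] := m'E e.
  by have [/M1/ltW|/M0 ->] := eqVneq (M e) 0.
rewrite phiD ?phiMn //; last exact: cocharMn.
rewrite phim phimu phid edge_formD edge_formMn (relint_edge_form relz) mul0rn add0r.
by rewrite /edge_form !mxE /= subrr !mulr0 !subr0.
Qed.

End Identification.
End Limits.

(** * Elementary triangles *)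

Section Triangles.
Variables (R : realType) (a b : nat).
Local Notation lpoint := (lpoint a b).
Implicit Types (T : {set lpoint}) (l : bool) (i j : nat).

(* The triangle with left edge from (i, 0) to (j, 1), whose third vertex is
   (i + 1, 0) if [l] and (j + 1, 1) otherwise; it meets the line of height 1/2
   along the segment from (i + j) / 2 to (i + j + 1) / 2. *)
Definition tri l i j : {set lpoint} := [set q : lpoint | match q with
  | inl x => (nat_of_ord x == i) || l && (nat_of_ord x == i.+1)
  | inr y => (nat_of_ord y == j) || ~~ l && (nat_of_ord y == j.+1)
  end].

(** All three vertices lie in the polygon; [tri] silently drops those outside. *)
Definition fits l i j : bool := (i + l <= a)%N && (j + ~~ l <= b)%N.

(** The determinant is 0 for three points on one base, and otherwise, up to sign, the distance of
    the two vertices on a common base. *)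
Lemma elementary_tri T : elementary T ->
  exists l i j, fits l i j /\ T = tri l i j.
Proof.
move=> [p [q [r [-> /eqP]]]].
have El (w x : 'I_a.+1) : ((inl w : lpoint) == inl x) = (w == x :> nat) by [].
have Er (w x : 'I_b.+1) : ((inr w : lpoint) == inr x) = (w == x :> nat) by [].
have low (x y : 'I_a.+1) (z : 'I_b.+1) : `|(y%:Z - x%:Z)| = 1 ->
    exists l i j, fits l i j /\ [set inl x; inl y; inr z] = tri l i j.
  move=> xy; exists true, (minn x y), z; split.
    by rewrite /fits; move: xy (ltn_ord x) (ltn_ord y) (ltn_ord z); lia.
  apply/setP => -[w|w]; rewrite !inE ?El ?Er ?orbF //=.
  by move: xy; lia.
have up (x : 'I_a.+1) (y z : 'I_b.+1) : `|(z%:Z - y%:Z)| = 1 ->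
    exists l i j, fits l i j /\ [set inl x; inr y; inr z] = tri l i j.
  move=> yz; exists false, x, (minn y z); split.
    by rewrite /fits; move: yz (ltn_ord x) (ltn_ord y) (ltn_ord z); lia.
  apply/setP => -[w|w]; rewrite !inE ?El ?Er ?orbF //=.
  by move: yz; lia.
case: p q r => [x|x] [y|y] [z|z] /= /eqP h.
- by lia.
- by apply: low; lia.
- by rewrite finset.setUAC; apply: low; lia.
- by apply: up; lia.
- by rewrite -finset.setUA finset.setUC; apply: low; lia.
- by rewrite [[set inr x; _]]finset.setUC; apply: up; lia.
- by rewrite finset.setUC finset.setUA; apply: up; lia.
- by lia.
Qed.

Lemma tri_sub l i j l' i' j' : fits l i j -> tri l i j \subset tri l' i' j' ->
  [/\ l = l', i = i' & j = j'].
Proof.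
move=> /andP[hi hj] /fintype.subsetP sub.
have subl x : (x <= a)%N -> (x == i) || l && (x == i.+1) ->
    (x == i') || l' && (x == i'.+1).
  by rewrite -ltnS => xa hx; have := sub (inl (Ordinal xa)); rewrite !inE /=; apply.
have subr y : (y <= b)%N -> (y == j) || ~~ l && (y == j.+1) ->
    (y == j') || ~~ l' && (y == j'.+1).
  by rewrite -ltnS => yb hy; have := sub (inr (Ordinal yb)); rewrite !inE /=; apply.
have := subl i; have := subl i.+1; have := subr j; have := subr j.+1.
by case: (l) hi hj; case: (l') => /= *; split; lia.
Qed.

Lemma in_hull_mid T (x : 'I_a.+1) (y : 'I_b.+1) : inl x \in T -> inr y \in T ->
  in_hull T ((x + y)%:R / 2, 2^-1 : R).
Proof.
move=> xT yT; pose c q : R := if (q == inl x) || (q == inr y) then 2^-1 else 0.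
have c0 q : 0 <= c q by rewrite /c; case: ifP; rewrite ?invr_ge0.
have sumc (g : lpoint -> R) : \sum_(q in T) c q * g q = 2^-1 * g (inl x) + 2^-1 * g (inr y).
  rewrite (bigD1 (inl x)) //= (bigD1 (inr y)) /= ?yT // /c !eqxx orbT big1 ?addr0 //.
  by move=> q /andP[/andP[_ /negbTE ->] /negbTE ->]; rewrite mul0r.
exists c; split=> //=; rewrite ?sumc /=.
- by rewrite -(eq_bigr _ (fun q _ => mulr1 (c q))) sumc; lra.
- by rewrite natrD; lra.
- by lra.
Qed.

Lemma in_hull_form T (p : R * R) (al be ga : R) : in_hull T p ->
  (forall q, q \in T -> al * (xc q)%:R + be * (yc q)%:R + ga = 0) ->
  al * p.1 + be * p.2 + ga = 0.
Proof.
move=> [c [_ c1 -> ->]] h.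
have -> : ga = \sum_(q in T) ga * c q by rewrite -mulr_sumr c1 mulr1.
rewrite !mulr_sumr -!big_split big1 //= => q qT.
by have := congr1 ( *%R (c q)) (h q qT); rewrite mulr0 => <-; ring.
Qed.

Lemma tri_hull_left l i j : fits l i j ->
  in_hull (tri l i j) ((i + j)%:R / 2, 2^-1 : R).
Proof.
move=> /andP[hi hj]; have xi : (i < a.+1)%N by lia. have yj : (j < b.+1)%N by lia.
by apply: (@in_hull_mid _ (Ordinal xi) (Ordinal yj)); rewrite inE /= eqxx.
Qed.

Lemma tri_hull_right l i j : fits l i j ->
  in_hull (tri l i j) ((i + j).+1%:R / 2, 2^-1 : R).
Proof.
move=> /andP[xi yj]; rewrite -ltnS in xi; rewrite -ltnS in yj.
have -> : (i + j).+1 = (i + l + (j + ~~ l))%N by case: (l) => /=; lia.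
by apply: (@in_hull_mid _ (Ordinal xi) (Ordinal yj)); rewrite inE /=; case: (l) => /=; lia.
Qed.

(** Compare the midpoint of the right edge of the first triangle with that of the left edge of the
    second. *)
Lemma tri_crossed l i j l' i' j' : fits l i j -> fits l' i' j' ->
  crossed_before R (tri l i j) (tri l' i' j') -> (i + j < i' + j')%N.
Proof.
move=> /tri_hull_right h /tri_hull_left h' /(_ _ _ h h').
by rewrite ler_pM2r ?invr_gt0 // ler_nat.
Qed.

(** These two midpoints coincide, so the point lies in the hull of the common vertices, which must
    then include both ends of the right edge. *)
Lemma tri_adjacent l i j l' i' j' : fits l i j -> fits l' i' j' ->
  (i' + j' = (i + j).+1)%N ->
  (forall p : R * R, in_hull (tri l i j) p -> in_hull (tri l' i' j') p ->
     in_hull (tri l i j :&: tri l' i' j') p) ->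
  i' = (i + l)%N /\ j' = (j + ~~ l)%N.
Proof.
move=> hij /tri_hull_left h2 e hull; have h1 := tri_hull_right hij.
have hI := hull _ h1 (eq_rect _ (fun k => in_hull _ (k%:R / 2, _)) h2 _ e).
have e1 : (i + j).+1 = (i + l + (j + ~~ l))%N by case: (l) => /=; lia.
move: hij => /andP[xi yj]; rewrite -ltnS in xi; rewrite -ltnS in yj.
(* The barycentric coordinate of a vertex of the right edge missing from the
   intersection would vanish on the midpoint of that edge. *)
have form al be ga : al * ((i + j).+1%:R / 2) + be * 2^-1 + ga <> 0 :> R ->
    (forall q, q \in tri l i j -> q \in tri l' i' j' ->
       al * (xc q)%:R + be * (yc q)%:R + ga = 0) -> False.
  by move=> n0 h; apply/n0/(in_hull_form hI) => q; rewrite inE => /andP[]; exact: h.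
have ri : inl (Ordinal xi) \in tri l' i' j'.
  apply/negPn/negP => /negP nI.
  have notI (w : 'I_a.+1) : inl w \in tri l' i' j' -> w <> (i + l)%N :> nat.
    by move=> wI ew; apply: nI; suff <- : w = Ordinal xi by []; exact: val_inj.
  case: (l) form notI => form notI /=.
    (* The form [x + (i - j) y - i] vanishes on the left edge; below, [1 - y] and [y] vanish on the
       upper and the lower base. *)
    apply: (form 1 (i%:R - j%:R) (- i%:R)) => [|[w|w]].
    - by rewrite -addn1 !natrD; lra.
    - by rewrite inE /= => /orP[/eqP -> _|/eqP ew /notI]; [ring | rewrite ew addn1].
    - by rewrite inE /= orbF => /eqP -> _; ring.
  apply: (form 0 (-1) 1) => [|[w|w]]; first by lra.
    by rewrite inE /= orbF => /eqP ew /notI; rewrite ew addn0.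
  by move=> _ _ /=; ring.
have rj : inr (Ordinal yj) \in tri l' i' j'.
  apply/negPn/negP => /negP nI.
  have notI (w : 'I_b.+1) : inr w \in tri l' i' j' -> w <> (j + ~~ l)%N :> nat.
    by move=> wI ew; apply: nI; suff <- : w = Ordinal yj by []; exact: val_inj.
  case: (l) form notI => form notI /=.
    apply: (form 0 1 0) => [|[w|w]]; first by lra.
      by move=> _ _ /=; ring.
    by rewrite inE /= orbF => /eqP ew /notI; rewrite ew addn0.
  apply: (form 1 (i%:R - j%:R) (- i%:R)) => [|[w|w]].
  - by rewrite -addn1 !natrD; lra.
  - by rewrite inE /= orbF => /eqP -> _; ring.
  - by rewrite inE /= => /orP[/eqP -> _|/eqP ew /notI]; [ring | rewrite ew addn1].
by move: ri rj; rewrite !inE /=; case: (l) e => /=; case: (l') => /=; lia.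
Qed.

End Triangles.

(** * Numberings and sequences *)

Section Numbering.
Variables (R : realType) (a b : nat) (pi : {perm 'I_(a + b)}).
Local Notation n := (a + b)%N.
Local Notation lpoint := (lpoint a b).
Local Notation edge := (edge pi).
Local Notation sgn := (sgn pi).
Local Notation tri := (@tri a b).
Variables (phi : {ffun edge -> int} -> 'rV[int]_3) (theta : param R a b).
Implicit Types (T : 'I_n -> {set lpoint}) (omega : {perm 'I_n}).

Lemma tri_sgn_tri l i j : fits a b l i j -> tri_sgn (tri l i j) = if l then -1 else 1.
Proof.
move=> /andP[hi hj]; rewrite /tri_sgn; set S := [set y | _]; have Sy (y : 'I_b.+1) : y \in S =
    (nat_of_ord y == j) || ~~ l && (nat_of_ord y == j.+1) by rewrite !inE.
clearbody S; case: l Sy hi hj => Sy hi hj; rewrite ltnNge.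
  suff -> : (#|S| <= 1)%N by [].
  by apply/card_le1_eqP => x y; rewrite !Sy /= !orbF => /eqP ex /eqP ey;
    apply: val_inj; rewrite /= ex ey.
suff -> : (#|S| <= 1)%N = false by [].
apply/negP => /card_le1_eqP cS.
have h1 : (j < b.+1)%N by lia. have h2 : (j.+1 < b.+1)%N by move: hj => /=; lia.
have := cS (Ordinal h1) (Ordinal h2); rewrite !Sy /= !eqxx orbT.
by move=> /(_ isT isT) [] /eqP; lia.
Qed.

(** The sums [i + j] increase strictly with [m] and stay below [n], so they are the numbers [m]. *)
Lemma numbering_tri T : numbering phi theta T ->
  forall m, exists l i j, [/\ fits a b l i j, T m = tri l i j & (i + j)%N = m].
Proof.
move=> [D [[el _ _] _ _ TD cr]].
have ex m : exists s, exists l i j, [/\ fits a b l i j, T m = tri l i j & (i + j)%N = s].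
  have /el/elementary_tri [l [i [j [fi Tm]]]] : T m \in D by apply/TD; exists m.
  by exists (i + j)%N, l, i, j.
have [s sP] := choice ex.
suff se : forall m, s m = m by move=> m; have := sP m; rewrite se.
apply: mono_ord_id => [m|m m' /cr].
  have [l [i [j [/andP[hi hj] _ <-]]]] := sP m.
  by move: hi hj; case: (l) => /=; lia.
have [l [i [j [fi -> <-]]]] := sP m; have [l' [i' [j' [fi' -> <-]]]] := sP m'.
exact: tri_crossed.
Qed.

(** Each [T m] is a cone of the fan, hence contained in some [T' m']; by [tri_sub] they are equal,
    and [i + j] gives [m = m']. *)
Lemma numbering_unique T T' : numbering phi theta T -> numbering phi theta T' -> T =1 T'.
Proof.
move=> nT nT' m; have [l [i [j [fi Tm s]]]] := numbering_tri nT m.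
have := numbering_tri nT'; case: nT nT' => [D [_ [_ fD] _ TD _]] [D' [_ [_ fD'] _ TD' _]] tr'.
have /fD' [U /TD'[m' ->]] : in_fan phi theta (T m).
  by apply/fD; exists (T m) => //; apply/TD; exists m.
have [l' [i' [j' [fi' Tm' s']]]] := tr' m'; rewrite Tm Tm' => /(tri_sub fi)[el ei ej].
suff -> : m = m' by rewrite Tm' el ei ej.
by apply: val_inj; rewrite /= -s -s' ei ej.
Qed.

(** For [s] equal to -1 and 1, these are the abscissas of the lower and upper ends of the left edge
    of triangle [k]. *)
Definition count_before omega (s : int) (k : nat) : nat :=
  count (fun m => sgn (omega m) == s) (take k (enum 'I_n)).

Lemma count_beforeS omega s (k : 'I_n) :
  count_before omega s k.+1 = (count_before omega s k + (sgn (omega k) == s))%N.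
Proof.
rewrite /count_before (take_nth k) ?size_enum_ord // nth_ord_enum -cats1 count_cat /=.
by rewrite addn0.
Qed.

(** Induction on [k]: each triangle starts at the right edge of the previous one, whose sign tells
    the base along which that edge has advanced. *)
Lemma numbering_count T omega : numbering phi theta T ->
  (forall k, sgn (omega k) = tri_sgn (T k)) -> forall k : 'I_n,
  [/\ fits a b (sgn (omega k) == -1) (count_before omega (-1) k) (count_before omega 1 k) &
   T k = tri (sgn (omega k) == -1) (count_before omega (-1) k) (count_before omega 1 k)].
Proof.
move=> nT sT; have trT := numbering_tri nT.
suff H : forall k : nat, forall hk : (k < n)%N, let m := Ordinal hk in exists l,
    fits a b l (count_before omega (-1) m) (count_before omega 1 m) /\
    T m = tri l (count_before omega (-1) m) (count_before omega 1 m).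
  move=> k; have := H k (ltn_ord k); have -> /= : Ordinal (ltn_ord k) = k by exact: val_inj.
  move=> [l [fi Tk]]; suff -> : (sgn (omega k) == -1) = l by [].
  by rewrite sT Tk tri_sgn_tri //; case: (l).
elim=> [|k IH] hk /=.
  have [l [i [j [fi -> /eqP]]]] := trT (Ordinal hk).
  rewrite addn_eq0 => /andP[/eqP i0 /eqP j0]; rewrite i0 j0 in fi *.
  by exists l; rewrite /count_before take0.
have hk' : (k < n)%N by exact: ltnW.
have [l [fi Tk]] := IH hk'.
have [l' [i' [j' [fi' Tk1 s']]]] := trT (Ordinal hk).
have sk : sgn (omega (Ordinal hk')) = if l then -1 else 1 by rewrite sT Tk tri_sgn_tri.
have [l2 [i2 [j2 [fi2 Tk2 s2]]]] := trT (Ordinal hk').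
have sum : (i' + j' = (count_before omega (-1) k + count_before omega 1 k).+1)%N.
  have : tri l2 i2 j2 \subset tri l (count_before omega (-1) k) (count_before omega 1 k).
    by rewrite -Tk2 Tk.
  by move=> /(tri_sub fi2)[_ <- <-]; rewrite s2 s'.
have [ei ej] : i' = (count_before omega (-1) k + l)%N /\
    j' = (count_before omega 1 k + ~~ l)%N.
  apply: (@tri_adjacent R a b l _ _ l') => // p; rewrite -Tk -Tk1.
  case: nT => [D [[_ _ tD] _ _ TD _]].
  by apply: tD; apply/TD; [exists (Ordinal hk') | exists (Ordinal hk)].
exists l'; rewrite !(count_beforeS _ _ (Ordinal hk')) sk.
by move: fi' Tk1; rewrite ei ej; case: (l).
Qed.

Lemma numbering_meet T omega (k k1 : 'I_n) : numbering phi theta T ->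
  (forall k, sgn (omega k) = tri_sgn (T k)) -> k1 = k.+1 :> nat ->
  exists (i : 'I_a.+1) (j : 'I_b.+1),
    [/\ i = count_before omega (-1) k1 :> nat, j = count_before omega 1 k1 :> nat &
        T k :&: T k1 = [set inl i; inr j]].
Proof.
move=> nT sT kk1; have [f1 T1] := numbering_count nT sT k1.
have [f T0] := numbering_count nT sT k; have /andP[hi hj] := f1.
have xi : (count_before omega (-1) k1 < a.+1)%N by lia.
have yj : (count_before omega 1 k1 < b.+1)%N by lia.
exists (Ordinal xi), (Ordinal yj); split=> //; rewrite T0 T1.
have El (w x : 'I_a.+1) : ((inl w : lpoint) == inl x) = (w == x :> nat) by [].
have Er (w x : 'I_b.+1) : ((inr w : lpoint) == inr x) = (w == x :> nat) by [].
move: (count_beforeS omega (-1) k) (count_beforeS omega 1 k); rewrite -kk1.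
move: (sgn (omega k1) == -1) => l1.
move: (count_before omega (-1) k) (count_before omega 1 k) => x y.
move: (count_before _ _ _) (count_before _ _ _) xi yj => x1 y1 xi yj ei ej.
apply/setP => -[w|w]; rewrite !inE ?El ?Er ?orbF //= ?ei ?ej;
  by case: (sgn_cases pi (omega k)) => -> /=; case: l1; lia.
Qed.

Lemma mem_take_enum (k : nat) (m : 'I_n) : (m \in take k (enum 'I_n)) = (m < k)%N.
Proof.
rewrite -(mem_map val_inj) map_take val_enum_ord take_iota mem_iota add0n.
by rewrite leq_min ltn_ord andbT.
Qed.

Lemma mem_drop_enum (k : nat) (m : 'I_n) : (m \in drop k (enum 'I_n)) = (k <= m)%N.
Proof.
rewrite -(mem_map val_inj) map_drop val_enum_ord drop_iota mem_iota add0n.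
by have := ltn_ord m; rewrite /=; lia.
Qed.

Lemma subsequence_cat omega s (k : nat) : subsequence pi omega s =
  [seq omega m | m <- take k (enum 'I_n) & sgn (omega m) == s] ++
  [seq omega m | m <- drop k (enum 'I_n) & sgn (omega m) == s].
Proof. by rewrite -map_cat -filter_cat cat_take_drop. Qed.

(** With the next lemma, this turns a position in [omega] into one in the subsequence of its sign,
    as used by [corresponds]. *)
Lemma mem_take_subsequence omega (m : 'I_n) (k : nat) : (m < k)%N ->
  omega m \in take (count_before omega (sgn (omega m)) k)
    (subsequence pi omega (sgn (omega m))).
Proof.
move=> mk; rewrite (subsequence_cat _ _ k) take_size_cat ?size_map ?size_filter //.
by apply: map_f; rewrite mem_filter eqxx mem_take_enum.
Qed.

Lemma mem_drop_subsequence omega (m : 'I_n) (k : nat) : (k <= m)%N ->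
  omega m \in drop (count_before omega (sgn (omega m)) k)
    (subsequence pi omega (sgn (omega m))).
Proof.
move=> mk; rewrite (subsequence_cat _ _ k) drop_size_cat ?size_map ?size_filter //.
by apply: map_f; rewrite mem_filter eqxx mem_drop_enum.
Qed.

End Numbering.

(** * Interior edges *)

Section Interior.
Variables (R : realType) (a b : nat) (pi : {perm 'I_(a + b)}).
Hypothesis a_gt0 : (0 < a)%N.
Local Notation n := (a + b)%N.
Local Notation edge := (edge pi).
Local Notation zig := (zig pi).
Local Notation zag := (zag pi).
Local Notation sgn := (sgn pi).
Local Notation rep := (rep R pi).
Local Notation in_orbit := Defs.in_orbit.

(* When [b = 0], no line puts an arrow in the matching of the apex (0, 1); this
   representation, stable for every parameter and on the orbit of the ray of the
   apex, shows that this matching contains the loops. *)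
Definition line_rep : rep := [ffun e => if e is inl _ then 1 else 0].

(** For [b = 0] all strips are hexagonal and every node carries a loop. Both paths of a line arrow
    then contain a loop, and those of a loop consist of line arrows. *)
Lemma line_rep_relations : b = 0%N -> relations line_rep.
Proof.
move=> b0; have sg j : sgn j = -1.
  by rewrite /Defs.sgn; case: ifP => // /negbT; have := ltn_ord (pi j); lia.
have hex f : hexagonal pi f by rewrite /hexagonal !sg.
have loop_in f : exists h, inr h \in star_R pi f /\ inr h \in star_L pi f.
  exists (Sub f (hex f)); rewrite /star_R /star_L (insubT (hexagonal pi) (hex f)).
  by rewrite !mem_seq3 eqxx !orbT.
have prod0 s (e : edge) (r : seq edge) : perm_eq s (e :: r) ->
    (exists2 h, inr h \in s & inr h != e) -> \prod_(x <- r) line_rep x = 0.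
  move=> sr [h hs he]; have hr : inr h \in r.
    by have := perm_mem sr (inr h); rewrite hs inE (negbTE he).
  by rewrite (big_rem _ hr) /= ffunE mul0r.
have loop_white (e : edge) : exists h, inr h \in white_star e.
  rewrite /white_star; case: ifP => _.
    by have [h []] := loop_in (strip_right e); exists h.
  by have [h []] := loop_in (strip_left e); exists h.
have loop_black (e : edge) : exists h, inr h \in black_star e.
  rewrite /black_star; case: ifP => _.
    by have [h []] := loop_in (strip_left e); exists h.
  by have [h []] := loop_in (strip_right e); exists h.
case=> [[j z]|h].
  rewrite (prod0 _ _ _ (gamma_plus_perm _)) ?(prod0 _ _ _ (gamma_minus_perm _)) //.
    by have [h hb] := loop_black (inl (j, z)); exists h.
  by have [h hw] := loop_white (inl (j, z)); exists h.
have prod1 (r : seq edge) : all (fun x => if x is inl _ then true else false) r ->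
    \prod_(x <- r) line_rep x = 1.
  move=> /allP rl; rewrite big_seq big1 // => -[x|x] /rl //; by rewrite ffunE.
rewrite !prod1 // /gamma_plus /gamma_minus /rest_of_cycle /white_star /black_star
  /star_L /star_R /=.
  by rewrite valK; case: ifP => _; rewrite /rev /= ?eqxx.
by rewrite valK; case: ifP => _; rewrite /rev /= ?eqxx.
Qed.

(** The rightward arrows form a cycle through all the vertices, so no nonzero proper
    subrepresentation exists. *)
Lemma line_rep_stable theta : b = 0%N -> stable theta line_rep.
Proof.
move=> b0; split=> [|N sub /set0Pn[v vN] /negP[]]; first exact: line_rep_relations.
apply/eqP/setP => w; rewrite inE; move: w; apply: (ordS_ind (i := v)) => // j jN.
have := sub (rightward pi j); rewrite tail_rightward head_rightward; apply=> //.
by rewrite ffunE oner_neq0.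
Qed.

Variable phi : {ffun edge -> int} -> 'rV[int]_3.
Hypothesis phi_id : normalized_identification R phi.

Variables (theta : param R a b) (omega : {perm 'I_n}) (k k1 : 'I_n) (M : rep).
Hypothesis th : Theta theta.
Hypothesis cor : corresponds phi theta omega.
Hypothesis kk1 : k1 = k.+1 :> nat.
Hypothesis tauM : in_tau phi theta k k1 M.

(* On the orbit of [tau_(omega, k)], the arrow of the line [omega m] acting by a
   nonzero scalar is the zig if [tau_arrow m], and the zag otherwise. *)
Definition tau_arrow (m : 'I_n) : bool := (m <= k)%N == (sgn (omega m) == -1).

Lemma tau_Supp : (forall m z, (M (inl (omega m, z)) != 0) = (z == tau_arrow m)) /\
  (forall h, M (inr h) = 0).
Proof.
have [phiD phi0 phiS _ _] := phi_id.
have [[T nT sT] lower upper] := cor; have [T' nT' orb'] := tauM.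
have [i [j [ei ej TT]]] := numbering_meet nT sT kk1.
have orb : in_orbit phi theta [set inl i; inr j] M.
  by rewrite -TT !(numbering_unique nT nT').
have van q e : q \in [set inl i; inr j] -> e \in pmatch phi theta q -> M e = 0.
  exact: (pmatch_vanish phiD phi0 phiS th orb).
have vl e : e \in pmatch phi theta (inl i) -> M e = 0 by apply: van; rewrite !inE eqxx.
have vr e : e \in pmatch phi theta (inr j) -> M e = 0 by apply: van; rewrite !inE eqxx orbT.
(* The matching at (i, 0) kills this arrow on lines of sign -1, that at (j, 1) on lines of sign
   1. *)
have lineE m : M (inl (omega m, ~~ tau_arrow m)) = 0.
  have [low1 low2] := lower i; have [up1 up2] := upper j; rewrite /tau_arrow.
  have neg1 : (1 == -1 :> int) = false by [].
  have [mk|mk] := leqP m k; rewrite -ltnS -kk1 in mk.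
    have := mem_take_subsequence pi omega mk.
    case: (sgn_cases pi (omega m)) => ->; rewrite -?ei -?ej ?neg1 ?eqxx => om.
      exact/vr/up1/(map_f zig).
    exact/vl/low1/(map_f zag).
  rewrite ltnS in mk; have := mem_drop_subsequence pi omega mk.
  case: (sgn_cases pi (omega m)) => ->; rewrite -?ei -?ej ?neg1 ?eqxx => om.
    exact/vr/up2/(map_f zag).
  exact/vl/low2/(map_f zig).
have omV l : omega ((omega^-1)%g l) = l by rewrite permKV.
have Mline l : M (zig l) = 0 \/ M (zag l) = 0.
  rewrite -(omV l); have := lineE ((omega^-1)%g l).
  by case: (tau_arrow _) => /= ->; [right|left].
have Mloop h : M (inr h) = 0.
  have [b0|b_gt0] := posnP b.
    have [D [_ [fO _] _ _ _]] := nT.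
    (* The cone [V0] of [line_rep] has no lower vertex, as those matchings contain line arrows, and
       is not empty, as [line_rep] kills the loops. So it is the ray of the apex. *)
    have [V0 orb0] := fO _ (line_rep_stable theta b0).
    have van0 q e : q \in V0 -> e \in pmatch phi theta q -> line_rep e = 0.
      exact: (pmatch_vanish phiD phi0 phiS th orb0).
    have no_inl x : inl x \notin V0.
      apply/negP => xV; have [low1 low2] := lower x.
      have z_in : omega k \in subsequence pi omega (-1).
        apply: map_f; rewrite mem_filter mem_enum andbT /Defs.sgn.
        by case: ifP => // /negbT; have := ltn_ord (pi (omega k)); lia.
      move: z_in; rewrite -(cat_take_drop x (subsequence _ _ _)) mem_cat => /orP[] z_in.
        have /(van0 _ _ xV)/eqP := low1 _ (map_f _ z_in).
        by rewrite ffunE oner_eq0.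
      have /(van0 _ _ xV)/eqP := low2 _ (map_f _ z_in).
      by rewrite ffunE oner_eq0.
    have jE y : y = j :> 'I_b.+1.
      by apply: val_inj; move: (ltn_ord y) (ltn_ord j); rewrite /=; lia.
    have V0E : V0 = [set inr j].
      have [V00|[[x|y] qV]] := set_0Vmem V0; last first.
      - apply/setP => -[x|y']; rewrite !inE; first exact/negbTE/no_inl.
        by rewrite (jE y') eqxx -(jE y).
      - by have := no_inl x; rewrite qV.
      have relz := relint_cone_sum R V0 (fun=> 0%N).
      have [m [_ cm phim]] := orbit_exponents phiD phi0 phiS orb0 relz.
      move: phim; rewrite V00 big_set0 => /(phi0 _ cm)[eta etam] /setP /(_ (inr h)).
      by rewrite !inE ffunE etam subrr !eqxx.
    apply: vr; rewrite inE; apply/asboolP; exists line_rep; last by rewrite ffunE.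
    by rewrite -V0E.
  have relz := relint_cone_sum R [set inl i; inr j] (fun=> 0%N).
  have [m [m_ge0 cm _ SM]] := orbit_exponents phiD phi0 phiS orb relz.
  have mE e : (M e == 0) = (m e != 0).
    by have := congr1 (fun S : {set edge} => e \in S) SM; rewrite !inE => <-; rewrite negbK.
  (* As [a] and [b] are positive, both signs occur; the exponent of the loop is then the sum over a
     line of opposite sign, one of whose arrows has positive exponent. *)
  have [l sl] : exists l, sgn l != sgn (val h).
    have pv (x : 'I_n) : sgn ((pi^-1)%g x) = if (x < a)%N then -1 else 1.
      by rewrite /Defs.sgn permKV.
    have xa : (0 < n)%N by lia. have xb : (a < n)%N by lia.
    case: (sgn_cases pi (val h)) => ->.
      by exists ((pi^-1)%g (Ordinal xa)); rewrite pv /= a_gt0.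
    by exists ((pi^-1)%g (Ordinal xb)); rewrite pv /= ltnn.
  apply/eqP; rewrite mE (cochar_loop cm sl) gt_eqF //.
  have := m_ge0 (zig l); have := m_ge0 (zag l).
  by case: (Mline l) => /eqP; rewrite mE; lia.
split=> // m z; have [->|] := eqVneq z (tau_arrow m); last first.
  by case: z; case: (tau_arrow m) (lineE m) => //= ->; rewrite eqxx.
have := edge_orbit_line phiD phi0 phiS (omega m) th orb Mline Mloop.
have := lineE m; rewrite /Defs.zig /Defs.zag.
by case: (tau_arrow m) => /= ->; rewrite eqxx => -[].
Qed.

(** Writing the swap as an exclusive or makes two swaps compose by addition. *)
Lemma mem_SS j (V : {set edge}) e : (zig j \in V) = (zag j \notin V) ->
  (e \in SS j V) = (if e is inl (l, _) then l == j else false) (+) (e \in V).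
Proof.
have lineE l (z z' : bool) : (inl (l, z) == inl (j, z') :> edge) = (l == j) && (z == z').
  by rewrite (inj_eq inl_inj) xpair_eqE.
rewrite /SS; case zj: (zig j \in V); case zj': (zag j \in V) => //= _;
  case: e => [[l z]|h]; rewrite !inE //= !lineE; case: eqVneq => [->|] //=;
  by case: z; rewrite ?(zj : inl (j, true) \in V = _) ?(zj' : inl (j, false) \in V = _).
Qed.

End Interior.

(** * Comparison of the supports on both sides of the wall *)

Theorem theorem7p5 (R : realType) (a b : nat) (ha : (1 <= a)%N) (hab : (b <= a)%N)
    (pi omega : {perm 'I_(a + b)})
    (phi : {ffun edge pi -> int} -> 'rV[int]_3)
    (hphi : normalized_identification R phi)
    (k k1 : 'I_(a + b)) (hk : k1 = k.+1 :> nat)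
    (C C' : set (param R a b))
    (hC : chamber_of phi omega C)
    (* [omega s_k], as a composition of functions *)
    (hC' : chamber_of phi (tperm k k1 * omega)%g C')
    (theta theta' : param R a b) (htheta : C theta) (htheta' : C' theta')
    (M M' : rep R pi)
    (hM : in_tau phi theta k k1 M)
    (hM' : in_tau phi theta' k k1 M') :
  Supp M' = SS (omega k1) (SS (omega k) (Supp M)).
Proof.
have chTheta (D : set (param R a b)) t : chamber pi D -> D t -> Theta t.
  by move=> [t0 [_ _ Dt]] /Dt[].
have [SM LM] := tau_Supp ha hphi (chTheta _ _ hC.1 htheta) (hC.2 _ htheta) hk hM.
have [SM' LM'] := tau_Supp ha hphi (chTheta _ _ hC'.1 htheta') (hC'.2 _ htheta') hk hM'.
have kNk1 : k != k1 by rewrite -(inj_eq val_inj) /= hk; lia.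
(* The line [omega m] has position [tperm k k1 m] in the new sequence; its sign is unchanged, and
   only [k] and [k1] change sides of the cut. *)
have arrow m : tau_arrow pi (tperm k k1 * omega)%g k (tperm k k1 m) =
    (m == k) (+) (m == k1) (+) tau_arrow pi omega k m.
  rewrite /tau_arrow permM tpermK; case: tpermP => [->|->|/eqP nk /eqP nk1].
  - by rewrite eqxx (negbTE kNk1) hk ltnn leqnn; case: (_ == -1).
  - by rewrite eqxx [k1 == k]eq_sym (negbTE kNk1) hk ltnn leqnn; case: (_ == -1).
  - by rewrite (negbTE nk) (negbTE nk1).
have SM'' m z : (M' (inl (omega m, z)) != 0) =
    (z == (m == k) (+) (m == k1) (+) tau_arrow pi omega k m).
  by rewrite -arrow -SM' permM tpermK.
have xor (m : 'I_(a + b)) : (zig pi (omega m) \in Supp M) = (zag pi (omega m) \notin Supp M).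
  by rewrite !inE !SM; case: tau_arrow.
apply/setP => e; rewrite !mem_SS ?xor ?addbN //.
case: e => [[j z]|h]; last by rewrite !inE LM LM'.
rewrite !inE -(permKV omega j) SM'' SM !(inj_eq perm_inj).
by case: (_ == k); case: (_ == k1); case: z; case: tau_arrow.
Qed.
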